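(* Let $G$ be a graph with vertex set $[n]$ such that all but $k$ Laplacian eigenvalues $\lambda$ of $G$ (counted with multiplicity) satisfy $|1-\lambda|=o\left(\frac{1}{\sqrt{\ln n}}\right)$, and let $\lambda_1,\dots,\lambda_k$ be those $k$ Laplacian eigenvalues of $G$ that do not satisfy this. Suppose that the minimum degree $\delta$ of $G$ satisfies $\delta\gg\max\{k,\ln^4 n\}$, let $p\gg\max\{\frac{k}{\delta},\frac{\ln^4 n}{\delta}\}$ (with $p\le 1$), and let $G_p$ be the bond percolation of $G$ with probability $p$. Then almost surely $$|\lambda_i(L(G_p))-\lambda_i(L(G))|\le\left(2+\sqrt{\sum_{j=1}^k(1-\lambda_j)^2}+o(1)\right)\frac{1}{\sqrt{p\delta}}\qquad\text{for each }1\le i\le n.$$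
   Context: The bond percolation of a (deterministic) host graph $G$ on $[n]=\{1,\dots,n\}$ with probability $p$ is the random spanning subgraph $G_p$ of $G$ in which each edge $\{i,j\}$ of $G$ is retained with probability $p$, independently of the other edges. For a graph $H$ on $[n]$ with adjacency matrix $A(H)$ and diagonal degree matrix $D(H)$, the normalized Laplacian is $L(H)=I-D(H)^{-1/2}A(H)D(H)^{-1/2}$ (with $(D(H)^{-1/2})_{ii}=0$ if vertex $i$ has degree $0$); the Laplacian eigenvalues of $H$ are the eigenvalues of $L(H)$. For an $n\times n$ symmetric matrix $M$, $\lambda_1(M)\le\dots\le\lambda_n(M)$ are its eigenvalues in non-decreasing order, with multiplicity. (The exceptional eigenvalues $\lambda_1,\dots,\lambda_k$ in the claim are a separate notation, not the $k$ smallest eigenvalues.) The graph $G=G^{(n)}$ and $p=p(n)$, $k=k(n)$, $\delta=\delta(n)$ depend on $n$, and asymptotics are as $n\to\infty$: $f\gg h$ means $f(n)/h(n)\to\infty$; the bound $|1-\lambda|=o(1/\sqrt{\ln n})$ is uniform over the $n-k$ non-exceptional eigenvalues, i.e. there is a function $g(n)\to\infty$ such that they all satisfy $|1-\lambda|<1/(g(n)\sqrt{\ln n})$ while the $k$ exceptional ones satisfy $|1-\lambda|\ge 1/(g(n)\sqrt{\ln n})$; $o(1)$ is a deterministic quantity tending to $0$ (uniform in $i$); ''almost surely'' means with probability tending to $1$ as $n\to\infty$. *)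

(* Defs.v *)
From HB Require Import structures.
From mathcomp Require Import all_boot all_order all_algebra.
From mathcomp Require Import all_classical all_reals all_analysis.
From mathcomp.real_closed Require complex.

Set Implicit Arguments.
Unset Strict Implicit.
Unset Printing Implicit Defensive.

Import Order.TTheory GRing.Theory Num.Theory.
Import numFieldNormedType.Exports.
Local Open Scope classical_set_scope.
Local Open Scope ring_scope.

Record graph (n : nat) := Graph {
  adj :> rel 'I_n;
  adj_sym : symmetric adj;
  adj_irr : irreflexive adj }.

Definition edges n (G : graph n) : {set {set 'I_n}} :=
  [set [set ij.1; ij.2] | ij : 'I_n * 'I_n & G ij.1 ij.2]%SET.

Definition degree n (G : graph n) (i : 'I_n) : nat := #|[set j | G i j]%SET|.

(* Every degree is smaller than n, so for n > 0 the default value n of the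
   iterated minimum plays no role. *)
Definition min_degree n (G : graph n) : nat :=
  \big[minn/n]_(i < n) degree G i.

Section SpanningSubgraph.
Variables (n : nat) (G : graph n) (S : {set {set 'I_n}}).

Definition sub_adj : rel 'I_n := fun i j => G i j && ([set i; j] \in S)%SET.

Fact sub_adj_sym : symmetric sub_adj.
Proof. by move=> i j; rewrite /sub_adj adj_sym finset.setUC. Qed.

Fact sub_adj_irr : irreflexive sub_adj.
Proof. by move=> i; rewrite /sub_adj adj_irr. Qed.

Definition spanning_subgraph : graph n := Graph sub_adj_sym sub_adj_irr.
End SpanningSubgraph.

(* Probability that the bond percolation G_p has property Q: the sample space
   consists of the sets S of retained edges, with the product measure under
   which each edge of G is retained independently with probability p. *)
Definition percolation_prob (R : realType) n (G : graph n) (p : R)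
    (Q : graph n -> bool) : R :=
  \sum_(S in powerset (edges G) | Q (spanning_subgraph G S))
    \prod_(e in edges G) (if e \in S then p else 1 - p).

Lemma edges_spanning_subgraph n (G : graph n) (S : {set {set 'I_n}}) :
  S \subset edges G -> edges (spanning_subgraph G S) = S.
Proof.
move=> /fintype.subsetP sub; apply/setP => e; apply/imsetP/idP.
  by case=> -[i j]; rewrite inE /= => /andP[_ ?] ->.
move=> eS; have /imsetP[[i j]] := sub e eS; rewrite inE /= => Gij eE.
by exists (i, j); rewrite // inE /= /sub_adj Gij -eE.
Qed.

(* Sanity check: the edges are retained independently with probability p. *)
Lemma percolation_edges (R : realType) n (G : graph n) (p : R)
    (F : {set {set 'I_n}}) : F \subset edges G ->
  percolation_prob G p (fun H => F \subset edges H) = p ^+ #|F|.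
Proof.
move=> FE; rewrite -prodr_const.
pose a e := if e \in edges G then p else 0.
pose b e := if e \in F then 0 else if e \in edges G then 1 - p else 1.
transitivity (\prod_e (a e + b e)); last first.
  rewrite [RHS]big_mkcond; apply: eq_bigr => e _; rewrite /a /b.
  case: ifPn => eE; case: ifPn => eF; rewrite ?addr0 ?add0r ?subrKC //.
  by rewrite (fintype.subsetP FE e eF) in eE.
rewrite bigA_distr /percolation_prob [in LHS]big_mkcond [in RHS]big_mkcond /=.
apply: eq_bigr => S _; rewrite powersetE.
have [SE|/subsetPn[e eS eE]] := boolP (S \subset edges G); last first.
  by rewrite /= (bigD1 e) //= eS /a (negPf eE) mul0r.
rewrite edges_spanning_subgraph //=.
case: ifPn => [FS|/subsetPn[e eF eS]]; last first.
  by rewrite /= (bigD1 e) //= (negPf eS) /b eF mul0r.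
rewrite [LHS]big_mkcond; apply: eq_bigr => e _; rewrite /a /b.
have [eS|eS] := boolP (e \in S); first by rewrite (fintype.subsetP SE e eS).
by rewrite (contraNF (fintype.subsetP FS e) eS).
Qed.

Section Laplacian.
Variables (R : realType) (n : nat) (G : graph n).

Definition adjmx : 'M[R]_n := \matrix_(i, j) (G i j)%:R.

(* As 0^-1 = 0, the diagonal entry of an isolated vertex is 0. *)
Definition degmx_Nhalf : 'M[R]_n :=
  diag_mx (\row_i (Num.sqrt (degree G i)%:R)^-1).

Definition laplacian : 'M[R]_n :=
  1%:M - degmx_Nhalf *m adjmx *m degmx_Nhalf.

Lemma laplacian_sym : laplacian^T = laplacian.
Proof.
rewrite /laplacian linearB /= trmx1 !trmx_mul tr_diag_mx mulmxA.
congr (_ - _ *m _ *m _).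
by apply/matrixP => i j; rewrite !mxE adj_sym.
Qed.
End Laplacian.
Arguments laplacian R {n} G.

(* The eigenvalues of M with multiplicity, in non-decreasing order: the sorted
   list of the roots of the characteristic polynomial.  The default value
   [::] is never used for symmetric M, see spectrumP. *)
Definition spectrum (R : realType) n (M : 'M[R]_n) : seq R :=
  xget [::] [set s : seq R | sorted <=%R s /\
                             char_poly M = \prod_(x <- s) ('X - x%:P)].

Section SpectrumP.
Import complex.

Lemma spectrumP (R : realType) n (M : 'M[R]_n) : M^T = M ->
  [/\ sorted <=%R (spectrum M),
      char_poly M = \prod_(x <- spectrum M) ('X - x%:P)
    & size (spectrum M) = n].
Proof.
move=> Msym; suff [s sP] : exists s : seq R, sorted <=%R s /\
    char_poly M = \prod_(x <- s) ('X - x%:P).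
  have [srt chM] : [set s : seq R | sorted <=%R s /\
    char_poly M = \prod_(x <- s) ('X - x%:P)] (spectrum M).
    by apply: xgetPex; exists s.
  split => //; apply/eqP.
  by rewrite -eqSS -(size_prod_XsubC (spectrum M) id) -chM size_char_poly.
pose C : numClosedFieldType := complex.complex R.
have [s sP] : exists s : seq R, char_poly M = \prod_(x <- s) ('X - x%:P).
  pose f : {rmorphism R -> C} := complex.real_complex R.
  pose N : 'M[C]_n := map_mx f M.
  have Nh : N \is hermsymmx.
    apply: realsym_hermsym.
      apply/is_hermitianmxP; rewrite expr0 scale1r map_mx_id //.
      by rewrite /N map_trmx Msym.
    by apply/mxOverP => i j; rewrite mxE; apply/complex.complex_realP; exists (M i j).
  have /orthomx_spectralP Ndiag := hermitian_normalmx Nh.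
  have Nreal := hermitian_spectral_diag_real Nh.
  exists [seq complex.Re (spectral_diag N 0 i) | i <- enum 'I_n].
  apply: (map_poly_inj f); rewrite map_char_poly -/N.
  have -> : char_poly N = char_poly (diag_mx (spectral_diag N)).
    set P := spectralmx N in Ndiag *; set D := diag_mx _ in Ndiag *.
    have Punit : P \in unitmx := spectral_unit N.
    pose P' := map_mx polyC P; pose Q' := map_mx polyC (invmx P).
    have QP : Q' *m P' = 1%:M by rewrite -map_mxM mulVmx // map_mx1.
    rewrite Ndiag /char_poly /char_poly_mx !map_mxM -/P' -/Q'.
    have {1}-> : 'X%:M = Q' *m 'X%:M *m P'.
      by rewrite mul_mx_scalar -scalemxAl QP scalemx1.
    rewrite -mulmxBl -mulmxBr !det_mulmx mulrAC -det_mulmx QP det1 mul1r.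
    by [].
  rewrite char_poly_trig ?diag_mx_is_trig // rmorph_prod /= big_map big_enum /=.
  apply: eq_bigr => i _; rewrite rmorphB /= map_polyX map_polyC /= mxE eqxx mulr1n.
  by rewrite complex.RRe_real //; apply: (mxOverP Nreal).
exists (sort <=%R s); split; first exact: (sort_sorted (@le_total _ _)).
by rewrite sP; apply: perm_big; rewrite perm_sym perm_sort.
Qed.
End SpectrumP.

(* lambda M i is the (i+1)-st smallest eigenvalue of M. *)
Definition lambda (R : realType) n (M : 'M[R]_n) (i : 'I_n) : R :=
  nth 0 (spectrum M) i.

(* For a fixed g with g n -> +oo, the remaining eigenvalues of the n-th matrix
   satisfy |1 - x| < 1 / (g n * sqrt (ln n)) = o(1 / sqrt (ln n)). *)
Definition exceptional_eigenvalues (R : realType) (g : R) n (M : 'M[R]_n)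
    : seq R :=
  [seq x <- spectrum M | 1 / (g * Num.sqrt (ln n%:R)) <= `|1 - x|].

(* f >> h *)
Definition much_larger (R : realType) (f h : nat -> R) : Prop :=
  f n / h n @[n --> \oo] --> +oo.

(* Main.v *)
Require Import Defs.
From mathcomp Require Import all_boot all_order all_algebra.
From mathcomp Require Import all_classical all_reals all_analysis.
From mathcomp Require Import fingroup perm.
From mathcomp Require Import ring lra zify.
Import Order.TTheory GRing.Theory Num.Theory.
Import numFieldNormedType.Exports.

Set Implicit Arguments.
Unset Strict Implicit.
Unset Printing Implicit Defensive.

(** Write [B = 1 - L(G)], [t_i = p d_i] for the expected degrees, [D = p delta],
    [d'_i] for the degrees in the percolation [G_p], and
    [F = diag (sqrt (t_i / d'_i) - 1)].  Then
      [1 - L(G_p) = (1 + F) (B + C) (1 + F)],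
    where the normalised noise [C] has entries
    [(A(G_p) - p A(G))_ij / sqrt (t_i t_j)].  By Weyl's inequality ([weyl]) every
    eigenvalue moves by at most the norm of the quadratic form of
    [(1 + F) (B + C) (1 + F) - B].  Split [B = M + N], where [M] carries the
    exceptional eigenvalues ([spectral_split]).  Three terms arise
    ([laplacian_comparison]).

    The term with [C] gives the constant 2.  Its norm is at most
    [(2 + o(1)) / sqrt D] because the expectation of [tr ((sqrt D C)^L)] is at most
    [n (2 + (L + 1)^2 / sqrt D)^L] ([expected_trace_le],
    [normalized_noise_trace]); take [L] a large multiple of [ln n] and use
    Markov.  The trace is a sum over closed walks.  A walk moves to a new vertex
    (these moves have total weight at most 1), or back along a tree edge used
    exactly once, or jumps to a visited vertex at a cost [1 / sqrt D].  Without
    jumps there is at most one edge to go back along, which leaves two unit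
    choices per step.  With jumps there may be several, and a product of
    factorials of the numbers of such edges ([potential]) compensates exactly for
    that choice; this turns the count of walks into a one-step inequality
    ([cost_step]).

    The term with [N] is negligible: by Chernoff ([degree_mgf]) all the
    relative degree errors [x_i = (d'_i - t_i) / t_i] are at most
    [4 sqrt (ln n / D)], and the norm of [N] is [o(1 / sqrt (ln n))].

    The term with [M] is estimated in Frobenius norm
    ([qform_rescaling_bound]).  To first order [F_i = - x_i / 2], so
    [F M + M F] has Frobenius norm at most [sqrt (sum_i w_i x_i^2)], where
    [w_i] is the square norm of row [i] of [M] and [sum_i w_i] is
    [S2 = sum_j (1 - lambda_j)^2].  As [x_i^2] has mean at most [1 / D], this is
    [sqrt (S2 / D)], provided that the sum concentrates.  It does because
    [w_i <= 1 / delta]: [(d'_i - t_i)^2] is a linear term plus a sum over pairs of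
    distinct edges at [i] ([pair_noiseE]), and these pairs are uncorrelated
    ([pair_noise_cov]), so Chebyshev applies.  The second-order terms are at most
    of order [sqrt (sum_i w_i x_i^4)], hence of order [sqrt S2 / D], which is
    [o(1 / sqrt D)] since [S2 <= k] and [D >> k].

    All these failure probabilities are collected in one nonnegative function of
    the percolation ([deviation_cost]) whose mean is small.  This gives the
    claim with a fixed error and a failure probability below it
    ([laplacian_percolation_bound]); [diagonal_rate] then lets the error tend
    to 0 with [n]. *)

Local Open Scope ring_scope.

(** * Spectral theorem and Weyl inequality for real symmetric matrices *)

Lemma dotE (R : nzRingType) n (u v : 'rV[R]_n) :
  (u *m v^T) 0 0 = \sum_i u 0 i * v 0 i.
Proof. by rewrite mxE; apply: eq_bigr => i _; rewrite mxE. Qed.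

(** The Householder reflection that exchanges [v] and the first basis vector
    [e] has [v] as its first row. *)
Lemma householder (R : realFieldType) n (v : 'rV[R]_n.+1) :
  v *m v^T = 1%:M -> exists2 Q : 'M[R]_n.+1, Q *m Q^T = 1%:M & row 0 Q = v.
Proof.
move=> v1; have [->|vN] := eqVneq v (delta_mx 0 0).
  by exists 1%:M; rewrite ?trmx1 ?mulmx1 // rowE mulmx1.
pose e : 'rV[R]_n.+1 := delta_mx 0 0.
have ev : e *m v^T = (v 0 0)%:M.
  by rewrite [LHS]mx11_scalar -rowE !mxE.
have ve : v *m e^T = (v 0 0)%:M.
  by rewrite -[LHS]trmxK trmx_mul trmxK ev tr_scalar_mx.
have ee : e *m e^T = 1%:M by rewrite trmx_delta mul_delta_mx [LHS]mx11_scalar mxE.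
pose w := v - e.
have ww : w *m w^T = (2 - 2 * v 0 0)%:M.
  rewrite /w linearB /= mulmxBl !mulmxBr v1 ee ev ve.
  by apply/matrixP => i j; rewrite !mxE !mulrnBl; ring.
have w0 : 2 - 2 * v 0 0 != 0.
  apply: contraNneq vN => h.
  have : (w *m w^T) 0 0 = 0 by rewrite ww h mxE mul0rn.
  rewrite dotE => /eqP; rewrite psumr_eq0 => [|i _]; last by rewrite -expr2 sqr_ge0.
  move=> /allP h0; rewrite -subr_eq0; apply/eqP/rowP => i; rewrite [RHS]mxE.
  by have := h0 i (mem_index_enum _); rewrite /= mulf_eq0 orbb => /eqP.
have wE : w = v - e by [].
pose c := 2 / (2 - 2 * v 0 0).
clearbody w.
pose Q : 'M[R]_n.+1 := 1%:M - c *: (w^T *m w).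
have Qs : Q^T = Q by rewrite /Q linearB /= trmx1 linearZ /= trmx_mul trmxK.
exists Q.
  rewrite Qs /Q mulmxBl mul1mx mulmxBr mulmx1 -scalemxAl -scalemxAr scalerA.
  rewrite -mulmxA (mulmxA w) ww mul_scalar_mx -scalemxAr scalerA.
  have -> : c * c * (2 - 2 * v 0 0) = c + c by rewrite /c; field.
  by rewrite scalerDl; apply/matrixP => i j; rewrite !mxE; ring.
rewrite rowE -/e /Q mulmxBr mulmx1 -scalemxAr mulmxA {1}wE linearB /= mulmxBr ev ee.
rewrite -raddfB /= mul_scalar_mx scalerA.
have -> : c * (v 0 0 - 1) = -1 by rewrite /c; field.
by rewrite scaleN1r opprK wE addrC subrK.
Qed.

(** Induction on the size: the characteristic polynomial splits, so there is a
    unit eigenvector; in an orthonormal basis that starts with it, symmetry makes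
    the matrix block diagonal. *)
Lemma diagonalize_sym (R : realType) n (M : 'M[R]_n) : M^T = M ->
  exists P (d : 'rV[R]_n), P *m P^T = 1%:M /\ M = P^T *m diag_mx d *m P.
Proof.
elim: n => [|n IHn] in M *; first by exists 1%:M, 0; split; rewrite [LHS]flatmx0 [RHS]flatmx0.
move=> Ms; have [_ chM sz] := spectrumP Ms.
have [a ra] : exists a, root (char_poly M) a.
  move: chM sz; case: (spectrum M) => // a s -> _; exists a.
  by rewrite root_prod_XsubC mem_head.
have /eigenvalueP[v0 v0M v0N] : eigenvalue M a by rewrite eigenvalue_root_char.
have v0g : 0 < (v0 *m v0^T) 0 0.
  rewrite dotE lt_def sumr_ge0 ?andbT => [|i _]; last by rewrite -expr2 sqr_ge0.
  apply: contraNneq v0N => /eqP; rewrite psumr_eq0 => [|i _]; last by rewrite -expr2 sqr_ge0.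
  move=> /allP h0; apply/eqP/rowP => i; rewrite [RHS]mxE.
  by have := h0 i (mem_index_enum _); rewrite /= mulf_eq0 orbb => /eqP.
pose s := Num.sqrt ((v0 *m v0^T) 0 0).
have s0 : s != 0 by rewrite gt_eqF // sqrtr_gt0.
pose v := s^-1 *: v0.
have vM : v *m M = a *: v by rewrite /v -scalemxAl v0M !scalerA mulrC.
have v1 : v *m v^T = 1%:M.
  rewrite /v linearZ /= -scalemxAl -scalemxAr scalerA [v0 *m _]mx11_scalar.
  rewrite -(sqr_sqrtr (ltW v0g)) -/s scale_scalar_mx; congr (_%:M).
  by field.
have [Q QQ Qv] := householder v1.
have QQ' : Q^T *m Q = 1%:M by apply: mulmx1C.
pose M' := Q *m M *m Q^T.
have M's : M'^T = M' by rewrite /M' !trmx_mul trmxK Ms mulmxA.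
have M'0 : row 0 M' = a *: delta_mx 0 0.
  rewrite /M' !row_mul Qv vM -scalemxAl -Qv -row_mul QQ; congr (_ *: _).
  by rewrite rowE mulmx1.
have M'K : M = Q^T *m M' *m Q by rewrite /M' !mulmxA QQ' mul1mx -mulmxA QQ' mulmx1.
clearbody M'.
pose M1 := @drsubmx _ 1 n 1 n M'.
have M1s : M1^T = M1 by rewrite /M1 trmx_drsub M's.
have [P1 [d1 [PP1 M1E]]] := IHn M1 M1s.
have M'E : M' = block_mx a%:M 0 0 M1 :> 'M[R]_(1 + n).
  rewrite -[LHS](@submxK _ 1 n 1 n M'); congr block_mx.
  - rewrite [LHS]mx11_scalar !mxE; congr (_%:M).
    by have /rowP/(_ 0) := M'0; rewrite !mxE !eqxx mulr1 => <- ; congr (M' _ _); apply: val_inj.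
  - apply/rowP => j; rewrite !mxE.
    have /rowP/(_ (rshift 1 j)) := M'0; rewrite !mxE (_ : (rshift 1 j == 0 :> 'I_(1 + n)) =
      false) ?andbF ?mulr0 => [<-|]; last by [].
    by congr (M' _ _); apply: val_inj.
  - apply/colP => j; rewrite !mxE -M's mxE.
    have /rowP/(_ (rshift 1 j)) := M'0; rewrite !mxE (_ : (rshift 1 j == 0 :> 'I_(1 + n)) =
      false) ?andbF ?mulr0 => [<-|]; last by [].
    by congr (M' _ _); apply: val_inj.
pose P' : 'M[R]_(1 + n) := block_mx 1%:M 0 0 P1.
have PP' : P' *m P'^T = 1%:M.
  rewrite /P' tr_block_mx mulmx_block !trmx0 trmx1 !mulmx0 !mul0mx mulmx1 PP1 !addr0 add0r.
  by rewrite -scalar_mx_block.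
have M'D : M' = P'^T *m diag_mx (row_mx a%:M d1) *m P'.
  rewrite M'E /P' tr_block_mx diag_mx_row !mulmx_block !trmx0 trmx1 !mulmx0 !mul0mx !addr0 !add0r.
  rewrite mul1mx mulmx1 -M1E !mul0mx.
  suff -> : diag_mx (a%:M : 'rV_1) = a%:M by [].
  by apply/matrixP => i j; rewrite !mxE !ord1 !mulr1n.
exists (P' *m Q), (row_mx a%:M d1); split.
  by rewrite trmx_mul mulmxA -(mulmxA P') QQ mulmx1.
by rewrite M'K M'D trmx_mul !mulmxA.
Qed.

(** The eigenvalues can be listed in the order of [lambda], because the
    characteristic polynomial determines the multiset of its roots. *)
Lemma spectral_decomposition (R : realType) n (M : 'M[R]_n) : M^T = M ->
  exists2 P : 'M[R]_n, P *m P^T = 1%:M &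
    M = P^T *m diag_mx (\row_i lambda M i) *m P.
Proof.
move=> Ms; have [P [d [PP MD]]] := diagonalize_sym Ms.
have PP' : P^T *m P = 1%:M by apply: mulmx1C.
have [_ chM sz] := spectrumP Ms.
have chD : char_poly M = \prod_(i < n) ('X - (d 0 i)%:P).
  pose Pp := map_mx polyC P; pose Qp := map_mx polyC P^T.
  have QP : Qp *m Pp = 1%:M by rewrite -map_mxM PP' map_mx1.
  rewrite MD /char_poly /char_poly_mx !map_mxM -/Pp -/Qp.
  have {1}-> : 'X%:M = Qp *m 'X%:M *m Pp.
    by rewrite mul_mx_scalar -scalemxAl QP scalemx1.
  rewrite -mulmxBl -mulmxBr !det_mulmx mulrAC -det_mulmx QP det1 mul1r.
  rewrite -[LHS]/(char_poly (diag_mx d)) char_poly_trig ?diag_mx_is_trig //.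
  by apply: eq_bigr => i _; rewrite mxE eqxx mulr1n.
pose t := [tuple d 0 i | i < n].
have tu : perm_eq (spectrum M) t.
  apply: prod_XsubC_eq; rewrite -chM chD big_map /=.
  by rewrite -[X in _ = \prod_(j <- X) _]/(enum 'I_n) big_enum.
have szT : size (spectrum M) == n by apply/eqP.
have /tuple_permP[s sE] : perm_eq (Tuple szT) t by [].
have ls i : lambda M i = d 0 (s i).
  by rewrite /lambda -[spectrum M]/(tval (Tuple szT)) sE -tnth_nth !tnth_mktuple.
exists (row_perm s P).
  by rewrite tr_row_perm row_permE col_permE mulmxA -(mulmxA _ P) PP mulmx1 -perm_mxM
    fingroup.mulgV perm_mx1.
rewrite [LHS]MD; apply/matrixP => i j; rewrite !mxE /=.
rewrite (reindex_inj (@perm.perm_inj _ s)) /=; apply: eq_bigr => l _.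
by rewrite !mul_mx_diag !mxE ls.
Qed.

Lemma spectrum_lambda (R : realType) n (M : 'M[R]_n) : M^T = M ->
  spectrum M = [seq lambda M i | i <- enum 'I_n].
Proof.
move=> Ms; have [_ _ sz] := spectrumP Ms.
apply: (@eq_from_nth _ 0); first by rewrite size_map size_enum_ord sz.
move=> i; rewrite sz => lin; rewrite (nth_map (Ordinal lin)) ?size_enum_ord //.
by rewrite /lambda nth_enum_ord.
Qed.

Lemma lambda_le (R : realType) n (M : 'M[R]_n) (i j : 'I_n) : M^T = M ->
  (i <= j)%N -> lambda M i <= lambda M j.
Proof.
move=> Ms ij; have [srt _ sz] := spectrumP Ms.
by apply: (sorted_leq_nth le_trans le_refl) => //; rewrite inE sz.
Qed.

Definition sqnorm (R : nzRingType) n (v : 'rV[R]_n) : R := \sum_i v 0 i ^+ 2.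

Definition qform (R : nzRingType) n (M : 'M[R]_n) (v : 'rV[R]_n) : R :=
  (v *m M *m v^T) 0 0.

Lemma sqnorm_ge0 (R : realFieldType) n (v : 'rV[R]_n) : 0 <= sqnorm v.
Proof. by apply: sumr_ge0 => i _; rewrite sqr_ge0. Qed.

Lemma sqnorm_gt0 (R : realFieldType) n (v : 'rV[R]_n) : v != 0 -> 0 < sqnorm v.
Proof.
move=> vN; rewrite lt_def sqnorm_ge0 andbT; apply: contraNneq vN => /eqP.
rewrite psumr_eq0 => [/allP h0|i _]; last exact: sqr_ge0.
apply/eqP/rowP => i; rewrite [RHS]mxE.
by have := h0 i (mem_index_enum _); rewrite /= sqrf_eq0 => /eqP.
Qed.

Lemma sqnormE (R : comNzRingType) n (v : 'rV[R]_n) : sqnorm v = (v *m v^T) 0 0.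
Proof. by rewrite dotE; apply: eq_bigr => i _; rewrite expr2. Qed.

Lemma sqnorm_orth (R : comNzRingType) n (P : 'M[R]_n) (v : 'rV[R]_n) :
  P *m P^T = 1%:M -> sqnorm (v *m P) = sqnorm v.
Proof. by move=> PP; rewrite !sqnormE trmx_mul mulmxA -(mulmxA v) PP mulmx1. Qed.

Lemma qform_diag (R : comNzRingType) n (P : 'M[R]_n) (d v : 'rV[R]_n) :
  qform (P^T *m diag_mx d *m P) v = \sum_i d 0 i * (v *m P^T) 0 i ^+ 2.
Proof.
rewrite /qform !mulmxA; set w := v *m P^T.
have -> : w *m diag_mx d *m P *m v^T = w *m diag_mx d *m w^T.
  by rewrite /w trmx_mul trmxK !mulmxA.
rewrite dotE; apply: eq_bigr => i _.
by rewrite mul_mx_diag mxE -mulrA mulrCA -expr2.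
Qed.

(** Courant-Fischer by dimension count.  The combinations of the first [i + 1]
    eigenvectors of [M2] that are orthogonal to the first [i] eigenvectors of
    [M1] solve [i] equations in [i + 1] unknowns, so one of them is not 0.  On it
    [M2] is at most [lambda M2 i] and [M1] is at least [lambda M1 i]. *)
Lemma weyl_le (R : realType) n (M1 M2 : 'M[R]_n) c (i : 'I_n) :
  M1^T = M1 -> M2^T = M2 ->
  (forall v, qform M1 v <= qform M2 v + c * sqnorm v) ->
  lambda M1 i <= lambda M2 i + c.
Proof.
move=> S1 S2 hc.
have [P1 PP1 E1] := spectral_decomposition S1.
have [P2 PP2 E2] := spectral_decomposition S2.
have PP1' : P1^T *m P1 = 1%:M by apply: mulmx1C.
pose W := P2 *m P1^T.
have lei (a : 'I_i.+1) : (a < n)%N by apply: leq_trans (ltn_ord a) (ltn_ord i).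
have lti (a : 'I_i) : (a < n)%N by apply: ltn_trans (ltn_ord a) (ltn_ord i).
(* The coefficients [u] refer to the first [i + 1] eigenvectors of [M2]; they lie
   in [kermx K] when the combination is orthogonal to the first [i] eigenvectors
   of [M1]. *)
pose K : 'M[R]_(i.+1, i) := \matrix_(a, b) W (Ordinal (lei a)) (Ordinal (lti b)).
have : kermx K != 0.
  by rewrite kermx_eq0 /row_free neq_ltn ltnS rank_leq_col.
move=> /rowV0Pn[u /sub_kermxP uK uN].
pose y : 'rV[R]_n := \row_j if insub (val j) is Some a then u 0 a else 0.
have yE (a : 'I_i.+1) : y 0 (Ordinal (lei a)) = u 0 a.
  by rewrite mxE /= insubT // => la; congr (u 0 _); apply: val_inj.
have y0 (j : 'I_n) : (i < j)%N -> y 0 j = 0.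
  by move=> ij; rewrite mxE insubF // ltnS leqNgt ij.
have yN : y != 0.
  apply: contraNneq uN => y0'; apply/eqP/rowP => a.
  by rewrite -yE y0' !mxE.
pose x := y *m W.
have x0 (j : 'I_n) : (j < i)%N -> x 0 j = 0.
  move=> ji; have /rowP/(_ (Ordinal ji)) := uK; rewrite [LHS]mxE [RHS]mxE => uK0.
  rewrite -[RHS]uK0 /x mxE (bigID (fun l : 'I_n => (l < i.+1)%N)) /= [X in _ + X]big1 ?addr0;
    last first.
    by move=> l; rewrite -leqNgt => il; rewrite y0 // mul0r.
  rewrite (big_ord_narrow (ltn_ord i)) /=; apply: eq_bigr => a _.
  rewrite [in RHS]mxE; congr (_ * _).
    by rewrite -yE; congr (y 0 _); apply: val_inj.
  by congr (W _ _); apply: val_inj.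
pose v := y *m P2.
have vP2 : v *m P2^T = y by rewrite /v -mulmxA PP2 mulmx1.
have vP1 : v *m P1^T = x by rewrite /v /x /W mulmxA.
have sv : sqnorm v = sqnorm y by apply: sqnorm_orth.
have sx : sqnorm x = sqnorm y by rewrite -vP1 -sv; apply: sqnorm_orth; rewrite trmxK.
have sy : 0 < sqnorm y by apply: sqnorm_gt0.
have := hc v; rewrite {1}E1 {1}E2 !qform_diag vP1 vP2 sv => le12.
have l1 : lambda M1 i * sqnorm y <= \sum_j (\row_j lambda M1 j) 0 j * x 0 j ^+ 2.
  rewrite -sx /sqnorm mulr_sumr; apply: ler_sum => j _; rewrite mxE.
  have [ji|ij] := ltnP j i; first by rewrite x0 // expr0n !mulr0.
  by rewrite ler_wpM2r ?sqr_ge0 // lambda_le.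
have l2 : \sum_j (\row_j lambda M2 j) 0 j * y 0 j ^+ 2 <= lambda M2 i * sqnorm y.
  rewrite /sqnorm mulr_sumr; apply: ler_sum => j _; rewrite mxE.
  have [ij|ji] := ltnP i j; first by rewrite y0 // expr0n !mulr0.
  by rewrite ler_wpM2r ?sqr_ge0 // lambda_le.
rewrite -(ler_pM2r sy) mulrDl.
by apply: (le_trans l1); apply: (le_trans le12); rewrite lerD2r.
Qed.

Lemma weyl (R : realType) n (M1 M2 : 'M[R]_n) c (i : 'I_n) :
  M1^T = M1 -> M2^T = M2 ->
  (forall v, `|qform M1 v - qform M2 v| <= c * sqnorm v) ->
  `|lambda M1 i - lambda M2 i| <= c.
Proof.
move=> S1 S2 hc.
have h1 : lambda M1 i <= lambda M2 i + c.
  by apply: weyl_le => // v; have := hc v; rewrite ler_norml; lra.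
have h2 : lambda M2 i <= lambda M1 i + c.
  by apply: weyl_le => // v; have := hc v; rewrite ler_norml; lra.
by rewrite ler_norml; lra.
Qed.

(** * Bounds on quadratic forms *)

(** Lagrange's identity: the difference of the two sides is half the sum of the
    squares of [a i * b j - a j * b i]. *)
Lemma cauchy_schwarz (R : realFieldType) (I : finType) (a b : I -> R) :
  (\sum_i a i * b i) ^+ 2 <= (\sum_i a i ^+ 2) * (\sum_i b i ^+ 2).
Proof.
have : 0 <= \sum_i \sum_j (a i * b j - a j * b i) ^+ 2.
  by apply: sumr_ge0 => i _; apply: sumr_ge0 => j _; rewrite sqr_ge0.
have -> : \sum_i \sum_j (a i * b j - a j * b i) ^+ 2 =
    (\sum_i a i ^+ 2) * (\sum_i b i ^+ 2) + (\sum_i b i ^+ 2) * (\sum_i a i ^+ 2)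
    - 2 * ((\sum_i a i * b i) * (\sum_i a i * b i)).
  rewrite !big_distrlr /= mulr_sumr -big_split -sumrB /=; apply: eq_bigr => i _.
  rewrite mulr_sumr -big_split -sumrB /=; apply: eq_bigr => j _.
  by ring.
by rewrite expr2; lra.
Qed.

Lemma qformE (R : comNzRingType) n (M : 'M[R]_n) v :
  qform M v = \sum_i \sum_j v 0 i * M i j * v 0 j.
Proof.
rewrite /qform dotE exchange_big /=; apply: eq_bigr => j _.
by rewrite mxE mulr_suml.
Qed.

Lemma qform_le_frobenius (R : rcfType) n (M : 'M[R]_n) v :
  `|qform M v| <= Num.sqrt (\sum_i \sum_j M i j ^+ 2) * sqnorm v.
Proof.
have E0 : 0 <= \sum_i \sum_j M i j ^+ 2.
  by apply: sumr_ge0 => i _; apply: sumr_ge0 => j _; rewrite sqr_ge0.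
rewrite -(@ler_pXn2r _ 2) ?nnegrE ?mulr_ge0 ?sqrtr_ge0 ?sqnorm_ge0 //.
rewrite real_normK ?num_real // exprMn sqr_sqrtr // qformE.
rewrite !pair_big /=.
under eq_bigr do rewrite mulrAC -mulrC.
apply: (le_trans (cauchy_schwarz _ _)).
rewrite ler_wpM2l //; first by apply: sumr_ge0 => i _; rewrite sqr_ge0.
rewrite expr2 /sqnorm big_distrlr /= pair_big /= le_eqVlt; apply/orP; left; apply/eqP.
by apply: eq_bigr => i _; rewrite exprMn.
Qed.

(** The form that uses the operator norm of a matrix with small eigenvalues on two
    vectors of very different sizes. *)
Lemma spectral_bilinear_bound (R : rcfType) n (P : 'M[R]_n) (d x y : 'rV[R]_n) nu c :
  P *m P^T = 1%:M -> (forall i, `|d 0 i| <= nu) -> 0 <= nu -> 0 <= c ->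
  sqnorm x <= c ^+ 2 * sqnorm y ->
  `|(x *m (P^T *m diag_mx d *m P) *m y^T) 0 0| <= nu * c * sqnorm y.
Proof.
move=> PP dn nu0 c0 xy.
have PP' : P^T *m P = 1%:M by apply: mulmx1C.
set a := x *m P^T; set b := y *m P^T.
have sa : sqnorm a = sqnorm x by apply: sqnorm_orth; rewrite trmxK.
have sb : sqnorm b = sqnorm y by apply: sqnorm_orth; rewrite trmxK.
have -> : x *m (P^T *m diag_mx d *m P) *m y^T = a *m diag_mx d *m b^T.
  by rewrite /a /b trmx_mul trmxK !mulmxA.
rewrite -(@ler_pXn2r _ 2) ?nnegrE ?mulr_ge0 ?sqnorm_ge0 //.
rewrite real_normK ?num_real // dotE.
apply: (le_trans (cauchy_schwarz _ _)).
rewrite -[X in _ * X]/(sqnorm b) sb.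
have : \sum_i (a *m diag_mx d) 0 i ^+ 2 <= nu ^+ 2 * sqnorm x.
  rewrite -sa /sqnorm mulr_sumr; apply: ler_sum => i _.
  rewrite mul_mx_diag mxE exprMn mulrC ler_wpM2r ?sqr_ge0 //.
  by rewrite -[leLHS]real_normK ?num_real // ler_pXn2r ?nnegrE.
move=> h; apply: (le_trans (ler_wpM2r (sqnorm_ge0 y) h)).
rewrite !exprMn [sqnorm y ^+ 2]expr2 mulrA ler_wpM2r ?sqnorm_ge0 //.
by rewrite -mulrA ler_wpM2l ?sqr_ge0.
Qed.

Lemma spectral_expr (R : comNzRingType) n (P : 'M[R]_n) (d : 'rV[R]_n) L :
  P *m P^T = 1%:M ->
  (P^T *m diag_mx d *m P) ^+ L = P^T *m diag_mx (\row_i d 0 i ^+ L) *m P.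
Proof.
move=> PP; have PP' : P^T *m P = 1%:M by apply: mulmx1C.
elim: L => [|L IH].
  rewrite expr0; have -> : \row_i d 0 i ^+ 0 = const_mx 1 by apply/rowP => i; rewrite !mxE.
  by rewrite diag_const_mx mulmx1 PP'.
rewrite exprS IH -[LHS]/(_ *m _) !mulmxA -(mulmxA _ P) PP mulmx1.
rewrite -(mulmxA P^T) mulmx_diag; congr (_ *m diag_mx _ *m _).
by apply/rowP => i; rewrite !mxE exprS.
Qed.

Lemma spectral_trace (R : comNzRingType) n (P : 'M[R]_n) (d : 'rV[R]_n) :
  P *m P^T = 1%:M -> \tr (P^T *m diag_mx d *m P) = \sum_i d 0 i.
Proof. by move=> PP; rewrite mxtrace_mulC mulmxA PP mul1mx mxtrace_diag. Qed.

(** An even power of an eigenvalue is at most the sum of the same powers of all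
    the eigenvalues, which is a trace. *)
Lemma qform_le_trace (R : realType) n (M : 'M[R]_n) (r : nat) tau v :
  M^T = M -> (0 < r)%N -> 0 <= tau -> \tr (M ^+ (r.*2)) <= tau ^+ r.*2 ->
  `|qform M v| <= tau * sqnorm v.
Proof.
move=> Ms r0 t0; have [P PP ->] := spectral_decomposition Ms.
set d := \row_i lambda M i.
rewrite spectral_expr // spectral_trace // => tr_le.
rewrite qform_diag; apply: (le_trans (ler_norm_sum _ _ _)).
have -> : sqnorm v = sqnorm (v *m P^T) by rewrite sqnorm_orth // trmxK mulmx1C.
rewrite /sqnorm mulr_sumr; apply: ler_sum => i _.
rewrite normrM [X in _ * X]ger0_norm ?sqr_ge0 // ler_wpM2r ?sqr_ge0 //.
rewrite -(@ler_pXn2r _ r.*2) ?nnegrE ?double_gt0 //.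
have ev x : `|x| ^+ r.*2 = x ^+ r.*2 :> R.
  by rewrite -mul2n !exprM real_normK ?num_real.
rewrite ev; apply: le_trans tr_le; rewrite (bigD1 i) //= [X in _ <= X + _]mxE lerDl.
by apply: sumr_ge0 => j _; rewrite mxE -ev exprn_ge0.
Qed.

(** * The product measure on sets of edges *)

Section ProductMeasure.
Variables (R : realFieldType) (T : finType) (E : {set T}) (p : R).

Definition expect (f : {set T} -> R) : R :=
  \sum_(S in powerset E) f S * \prod_(e in E) (if e \in S then p else 1 - p).

Lemma eq_expect (f g : {set T} -> R) :
  (forall S : {set T}, S \subset E -> f S = g S) -> expect f = expect g.
Proof. by move=> fg; apply: eq_bigr => S; rewrite powersetE => /fg ->. Qed.

Lemma expectD (f g : {set T} -> R) :
  expect (fun S => f S + g S) = expect f + expect g.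
Proof. by rewrite -big_split; apply: eq_bigr => S _; rewrite mulrDl. Qed.

Lemma expectZ c (f : {set T} -> R) : expect (fun S => c * f S) = c * expect f.
Proof. by rewrite mulr_sumr; apply: eq_bigr => S _; rewrite mulrA. Qed.

Lemma expect_sum (I : Type) (r : seq I) (P : pred I) (f : I -> {set T} -> R) :
  expect (fun S => \sum_(i <- r | P i) f i S) = \sum_(i <- r | P i) expect (f i).
Proof.
rewrite exchange_big /=; apply: eq_bigr => S _; by rewrite mulr_suml.
Qed.

(** Independence of the edges. *)
Lemma expect_prod (f : T -> bool -> R) :
  expect (fun S => \prod_e f e (e \in S)) =
  \prod_e (if e \in E then p * f e true + (1 - p) * f e false else f e false).
Proof.
pose a e := if e \in E then p * f e true else 0.
pose b e := if e \in E then (1 - p) * f e false else f e false.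
transitivity (\prod_e (a e + b e)); last first.
  by apply: eq_bigr => e _; rewrite /a /b; case: ifP => _; rewrite ?add0r.
rewrite bigA_distr /expect [LHS]big_mkcond /=; apply: eq_bigr => S _.
rewrite powersetE.
have [SE|/subsetPn[e eS eE]] := boolP (S \subset E); last first.
  by rewrite (bigD1 e) //= eS /a (negPf eE) mul0r.
rewrite [X in _ * X = _]big_mkcond -big_split /=; apply: eq_bigr => e _; rewrite /a /b.
have [eS|eS] := boolP (e \in S); first by rewrite (fintype.subsetP SE e eS) mulrC.
by case: ifP => _; rewrite ?mulr1 // mulrC.
Qed.

Lemma expect_cst c : expect (fun=> c) = c.
Proof.
have /eqP := expect_prod (fun=> fun=> 1).
rewrite /= [X in _ == X]big1 => [/eqP h|e _]; last by case: ifP => _ //; ring.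
rewrite -[RHS]mulr1 -[X in _ * X]h -expectZ; apply: eq_expect => S _.
by rewrite big1 ?mulr1.
Qed.

Hypothesis p01 : 0 <= p <= 1.

Lemma expect_le (f g : {set T} -> R) :
  (forall S : {set T}, S \subset E -> f S <= g S) -> expect f <= expect g.
Proof.
move=> fg; apply: ler_sum => S; rewrite powersetE => SE; rewrite ler_wpM2r ?fg //.
by apply: prodr_ge0 => e _; case: ifP => _; have := p01; lra.
Qed.

Lemma expect_ge0 (f : {set T} -> R) :
  (forall S : {set T}, S \subset E -> 0 <= f S) -> 0 <= expect f.
Proof. by move=> f0; rewrite -(expect_cst 0); apply: expect_le. Qed.

Definition centered (S : {set T}) (e : T) : R :=
  if e \in E then (e \in S)%:R - p else 0.

Definition moment (e : T) (m : nat) : R :=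
  if e \in E then p * (1 - p) ^+ m + (1 - p) * (- p) ^+ m else (m == 0%N)%:R.

Lemma prod_count (x : T -> R) (s : seq T) :
  \prod_(e <- s) x e = \prod_e x e ^+ count_mem e s.
Proof.
elim: s => [|a s IH]; first by rewrite big_nil big1.
rewrite big_cons IH (bigD1 a) // [RHS](bigD1 a) //= eqxx exprS mulrA; congr (_ * _).
by apply: eq_bigr => e ea; rewrite [a == e]eq_sym (negPf ea).
Qed.

Lemma expect_monomial (s : seq T) :
  expect (fun S => \prod_(e <- s) centered S e) = \prod_e moment e (count_mem e s).
Proof.
pose f e b := (if e \in E then b%:R - p else 0) ^+ count_mem e s.
transitivity (expect (fun S => \prod_e f e (e \in S))).
  by apply: eq_expect => S _; rewrite prod_count.
rewrite (expect_prod f).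
apply: eq_bigr => e _; rewrite /f /moment; case: (e \in E); last by rewrite expr0n.
by rewrite sub0r.
Qed.

Lemma moment0 e : moment e 0 = 1.
Proof. by rewrite /moment; case: ifP => _ //; rewrite !expr0; ring. Qed.

Lemma moment1 e : moment e 1 = 0.
Proof. by rewrite /moment; case: ifP => _ //; rewrite !expr1; ring. Qed.

Lemma moment_le e m : (1 < m)%N -> `|moment e m| <= (e \in E)%:R * p.
Proof.
move=> m1; rewrite /moment; case: ifP => _; last first.
  by rewrite mul0r; case: m m1 => // m _; rewrite normr0.
have [p0 p1] : 0 <= p /\ p <= 1 by apply/andP.
rewrite mul1r; apply: (le_trans (ler_normD _ _)).
have h (x : R) : 0 <= x -> x <= 1 -> x ^+ m <= x.
  by move=> x0 x1; rewrite -[leRHS]expr1 ler_wiXn2l // ltnW.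
rewrite !normrM !normrX normrN !ger0_norm ?subr_ge0 //.
have h1 : (1 - p) ^+ m <= 1 - p by apply: h; lra.
have h2 : p ^+ m <= p by apply: h; lra.
have : p * (1 - p) ^+ m <= p * (1 - p) by rewrite ler_wpM2l.
have : (1 - p) * p ^+ m <= (1 - p) * p ^+ 2.
  by rewrite ler_wpM2l ?subr_ge0 // ler_wiXn2l.
nra.
Qed.

End ProductMeasure.

Lemma percolation_probE (R : realType) n (G : graph n) (p : R)
    (Q : graph n -> bool) : percolation_prob G p Q =
  expect (edges G) p (fun S => (Q (spanning_subgraph G S))%:R).
Proof.
rewrite /percolation_prob /expect big_mkcondr /=; apply: eq_bigr => S _.
by case: (Q _); rewrite ?mul1r ?mul0r.
Qed.

(** Markov's inequality in the only form used here: several exceptional events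
    are handled at once by a sum [F] of ratios, each of which is at least 1 when
    its event occurs. *)
Lemma percolation_prob_ge (R : realType) n (G : graph n) (p : R)
    (Q : graph n -> bool) (F : {set {set 'I_n}} -> R) : 0 <= p <= 1 ->
  (forall S : {set {set 'I_n}}, S \subset edges G -> 0 <= F S) ->
  (forall S : {set {set 'I_n}}, S \subset edges G -> F S < 1 -> Q (spanning_subgraph G S)) ->
  1 - expect (edges G) p F <= percolation_prob G p Q.
Proof.
move=> p01 F0 FQ; rewrite percolation_probE lerBlDr -expectD -[leLHS](expect_cst (edges G) p).
apply: expect_le => // S SE.
case: (ltP (F S) 1) => [/(FQ _ SE) -> |h]; first by rewrite lerDl F0.
by rewrite (le_trans h) // lerDr.
Qed.

(** * Bookkeeping for walks: tree edges and the factorial potential *)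

Section Trail.
Variable n : nat.
Implicit Types (u z y : 'I_n) (h : seq 'I_n) (e : {set 'I_n}) (op : pred {set 'I_n}).

(** A walk is stored backwards: [u] is its current vertex and [h] lists the earlier
    ones, the last visited first. *)
Fixpoint trail u h : seq {set 'I_n} :=
  if h is w :: h' then [set u; w]%SET :: trail w h' else [::].

(** The edges along which a vertex was visited for the first time. *)
Fixpoint tree u h : seq {set 'I_n} :=
  if h is w :: h' then
    if u \in h then tree w h' else [set u; w]%SET :: tree w h'
  else [::].

Definition mult u h e := count_mem e (trail u h).

(** In a walk that contributes to the trace every edge is used at least twice, so
    an open edge is one that the walk still has to use again. *)
Definition opened u h : pred {set 'I_n} :=
  fun e => (e \in tree u h) && (mult u h e == 1%N).

Definition valence op y : nat := #|[set z | op [set y; z]%SET]%SET|.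

(** The weight that makes the walk count a one-step estimate.  The factorial at
    the current vertex pays for the choice of the open edge to go back along; at
    any other vertex one open edge is free, because going back to that vertex uses
    one up and leaves the factorial of the remaining ones. *)
Definition potential u op : nat :=
  ((valence op u)`! * \prod_(y | y != u) ((valence op y).-1)`!)%N.

Lemma tree_sub_trail u h e : e \in tree u h -> e \in trail u h.
Proof.
elim: h u => //= w h IH u; case: ifP => _; rewrite ?inE.
  by move=> /IH ->; rewrite orbT.
by case/orP => [->|/IH ->] //; rewrite orbT.
Qed.

Lemma tree_mult_gt0 u h e : e \in tree u h -> (0 < mult u h e)%N.
Proof. by move=> /tree_sub_trail; rewrite /mult -has_count has_pred1. Qed.

Lemma trail_visited u h e y : e \in trail u h -> y \in e -> y \in u :: h.
Proof.
elim: h u => //= w h IH u; rewrite [e \in _]inE => /orP[/eqP ->|/IH he /he].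
  by rewrite !inE orbA => ->.
by rewrite [_ \in u :: _]inE => ->; rewrite orbT.
Qed.

Lemma tree_card u h e : e \in tree u h -> #|e| = 2%N.
Proof.
elim: h u => //= w h IH u; case: ifP => [_ /IH //|uh]; rewrite inE => /orP[/eqP ->|/IH //].
by rewrite cards2; move: uh; rewrite inE; case: eqP.
Qed.

Lemma set2_inj u y z : ([set u; y] == [set u; z])%SET = (y == z).
Proof.
apply/eqP/eqP => [e|-> //].
have := set22 u y; rewrite e !inE => /orP[/eqP yu|/eqP //].
by have := set22 u z; rewrite -e yu !inE orbb => /eqP.
Qed.

Lemma valence_add op op' u z y : u != z ->
  ~~ op [set z; u]%SET ->
  (forall e, op' e = op e || (e == [set z; u]%SET)) ->
  valence op' y = (valence op y + (y \in [set z; u]%SET))%N.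
Proof.
move=> uz opN op'E; rewrite /valence.
have [yzu|yzu] /= := boolP (y \in [set z; u]%SET); last first.
  rewrite addn0; apply: eq_card => w; rewrite !inE op'E.
  case: eqP => [e|_]; last by rewrite orbF.
  by rewrite -e !inE eqxx in yzu.
pose y' := if y == z then u else z.
have e : [set z; u]%SET = [set y; y']%SET.
  move: yzu; rewrite /y' !inE; case: eqP => [-> //|_ /= /eqP ->].
  by rewrite finset.setUC.
rewrite [LHS](cardsD1 y') inE op'E e eqxx orbT addnC; congr (_ + _)%N.
apply: eq_card => w; rewrite !inE op'E e set2_inj.
by have [->|] := eqVneq w y'; rewrite ?orbF //= -e (negPf opN).
Qed.

Lemma potentialE u z op : u != z ->
  potential u op = ((valence op u)`! * ((valence op z).-1)`! *
    \prod_(y | (y != u) && (y != z)) ((valence op y).-1)`!)%N.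
Proof.
move=> uz; rewrite /potential -mulnA; congr (_ * _)%N.
by rewrite (bigD1 z) //= eq_sym.
Qed.

Lemma potential_gt0 u op : (0 < potential u op)%N.
Proof. by rewrite muln_gt0 fact_gt0 /= prodn_gt0 // => y; rewrite fact_gt0. Qed.

(** The valence of [u] grows by 1 as [u] stops being the current vertex, so its
    factorial does not change, and the new vertex has valence 1. *)
Lemma potential_new u h z : z \notin u :: h ->
  potential z (opened z (u :: h)) = potential u (opened u h).
Proof.
move=> zh.
have zu : z != u by move: zh; rewrite inE; case: eqP.
have opN y : ~~ opened u h [set z; y]%SET.
  apply/negP => /andP[/tree_sub_trail/trail_visited/(_ (set21 z y))].
  by rewrite (negPf zh).
have m0 : mult u h [set z; u]%SET = 0%N.
  apply/count_memPn; apply/negP => /trail_visited/(_ (set21 z u)).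
  by rewrite (negPf zh).
have op'E e : opened z (u :: h) e = opened u h e || (e == [set z; u]%SET).
  rewrite /opened /mult /= (negPf zh) inE [in RHS]orbC.
  have [->|ne] := eqVneq e [set z; u]%SET.
    by rewrite /= -/(mult u h _) m0.
  by [].
have uz : u != z by rewrite eq_sym.
have v0 : valence (opened u h) z = 0%N.
  by apply/eqP; rewrite cards_eq0; apply/eqP/setP => y; rewrite !inE; apply/negbTE.
have val := valence_add _ uz (opN u) op'E.
rewrite (potentialE _ zu) (potentialE _ uz) !val !inE !eqxx orbT v0 /= addn1 /=.
rewrite ?fact0 !mul1n muln1 addn1; congr (_ * _)%N.
apply: eq_big => [y|y /andP[yz yu]]; first by rewrite andbC.
by rewrite val !inE (negPf yu) (negPf yz) addn0.
Qed.

(** Going back lowers the valence [h] of [u] and makes [u] an ordinary vertex: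
    its factor passes from the factorial of [h] to that of [h - 2], which is
    smaller by a factor [h] at least.  That factor is the number of ways to go
    back. *)
Lemma potential_back u h z : opened u h [set z; u]%SET ->
  (potential z (opened z (u :: h)) * valence (opened u h) u <=
   potential u (opened u h))%N.
Proof.
move=> op; have /andP[tr /eqP m1] := op.
have uz : u != z.
  by have := tree_card tr; rewrite cards2 eq_sym; case: eqP.
have zu : z != u by rewrite eq_sym.
have zh : z \in u :: h.
  exact: (trail_visited (tree_sub_trail tr) (set21 z u)).
have op'E e : opened u h e = opened z (u :: h) e || (e == [set z; u]%SET).
  rewrite /opened /mult /= zh orbC.
  have [->|ne] := eqVneq e [set z; u]%SET.
    by rewrite /= -/(mult u h _) m1 tr.
  by [].
have opN : ~~ opened z (u :: h) [set z; u]%SET.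
  by rewrite /opened /mult /= eqxx -/(mult u h _) m1 andbF.
have val := valence_add _ uz opN op'E.
rewrite (potentialE _ zu) (potentialE _ uz) !val !inE !eqxx orbT /= !addn1 /=.
set a := valence _ u; set b := valence _ z.
rewrite mulnAC leq_mul //.
  by rewrite factS; case: a => [|a]; rewrite /= ?fact0 ?muln1 ?mul1n // factS; nia.
rewrite leq_eqVlt; apply/orP; left; apply/eqP.
apply: eq_big => [y|y /andP[yz yu]]; first by rewrite andbC.
by rewrite val !inE (negPf yu) (negPf yz) addn0.
Qed.

Lemma valence_visited u h y : (valence (opened u h) y <= (size h).+1)%N.
Proof.
rewrite -[(size h).+1]/(size (u :: h)); apply: leq_trans (card_size (u :: h)).
apply: subset_leq_card; apply/fintype.subsetP => z; rewrite inE.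
by move=> /andP[/tree_sub_trail/trail_visited/(_ (set22 y z))].
Qed.

(** Only the factors of [u] and [z] change; that of [z] is multiplied by its
    valence, which is at most the number of visited vertices. *)
Lemma potential_jump u h z : z \in u :: h -> ~~ opened u h [set z; u]%SET ->
  (potential z (opened z (u :: h)) <= potential u (opened u h) * (size h).+1)%N.
Proof.
move=> zh opN.
have op'E e : opened z (u :: h) e = opened u h e.
  rewrite /opened /mult /= zh; have [<-|ne] := eqVneq [set z; u]%SET e; last by [].
  have [tr|trN] := boolP ([set z; u]%SET \in tree u h); last by [].
  move: opN (tree_mult_gt0 tr); rewrite /opened tr /mult /=; lia.
have valE y : valence (opened z (u :: h)) y = valence (opened u h) y.
  by apply: eq_card => w; rewrite !inE op'E.
have [zu|zu] := eqVneq z u.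
  subst z; rewrite /potential valE (eq_bigr (fun y => ((valence (opened u h) y).-1)`!)).
    by rewrite leq_pmulr.
  by move=> y _; rewrite valE.
have uz : u != z by rewrite eq_sym.
rewrite (potentialE _ zu) (potentialE _ uz) !valE.
have := valence_visited u h z; set a := valence _ u; set b := valence _ z => bh.
rewrite [leqRHS]mulnAC; apply: leq_mul; last first.
  rewrite leq_eqVlt; apply/orP; left; apply/eqP; apply: eq_big => [y|y _].
    by rewrite andbC.
  by rewrite valE.
have ha : (a.-1`! <= a`!)%N by case: a => // a; rewrite factS leq_pmull.
have hb : (b`! <= b.-1`! * (size h).+1)%N.
  by case: b bh => [|b] bh; rewrite ?fact0 ?mul1n //= factS mulnC leq_mul2l bh orbT.
by rewrite [(b`! * _)%N]mulnC -mulnA leq_mul.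
Qed.

End Trail.

(** * The trace method *)

Lemma sum_indicator (I : finType) (A : pred I) : (\sum_i A i = #|A|)%N.
Proof.
rewrite -sum1_card [RHS]big_mkcond; apply: eq_bigr => i _.
by rewrite unfold_in; case: (A i).
Qed.

(** The random entries enter only through bounds on their moments: [mom e m] is
    the [m]-th moment of the entry at [e], [s e] bounds its variance and
    [kappa] its size.  The row sums of the variances are at most 1. *)
Section TraceBound.
Variables (R : realFieldType) (n : nat).
Variables (mom : {set 'I_n} -> nat -> R) (s : {set 'I_n} -> R) (kappa : R).
Hypothesis mom0 : forall e, mom e 0 = 1.
Hypothesis mom1 : forall e, mom e 1 = 0.
Hypothesis mom_le : forall e m, `|mom e m.+2| <= s e * kappa ^+ m.
Hypothesis kappa_ge0 : 0 <= kappa.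
Hypothesis s_ge0 : forall e, 0 <= s e.
Hypothesis s_le : forall e, s e <= kappa ^+ 2.
Hypothesis s_row : forall u, \sum_z s [set z; u]%SET <= 1.

(** Upper bound for the moment of the entry at [e] after the walk.  A tree edge is
    charged its variance at once, which is what makes the moves to new vertices
    summable; the other edges are charged [kappa] for each passage. *)
Definition edge_weight u h e : R :=
  if e \in tree u h then s e * kappa ^+ (mult u h e - 2)
  else kappa ^+ mult u h e.

Definition weight (u : 'I_n) h : R := \prod_e edge_weight u h e.

Lemma edge_weight_ge0 u h e : 0 <= edge_weight u h e.
Proof. by rewrite /edge_weight; case: ifP => _; rewrite ?mulr_ge0 ?exprn_ge0. Qed.

Lemma weight_ge0 u h : 0 <= weight u h.
Proof. by apply: prodr_ge0 => e _; apply: edge_weight_ge0. Qed.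

(** An edge used exactly once has moment 0, so open edges are no loss here. *)
Lemma moment_le_weight u h :
  `|\prod_e mom e (mult u h e)| <= weight u h.
Proof.
rewrite normr_prod; apply: ler_prod => e _; rewrite normr_ge0 /= /edge_weight.
have := @tree_mult_gt0 _ u h e.
case: (mult u h e) => [|[|m]].
- by case: ifP => [_ /(_ isT)|_ _] //; rewrite mom0 normr1.
- by rewrite mom1 normr0 => _; case: ifP => _; rewrite ?mulr_ge0 ?exprn_ge0.
move=> _; rewrite subSS subSS subn0; case: ifP => _ //.
by apply: (le_trans (mom_le e m)); rewrite [leRHS]exprS exprS mulrA -expr2 ler_wpM2r ?exprn_ge0.
Qed.

Lemma weight_step u h z c :
  edge_weight z (u :: h) [set z; u]%SET = c * edge_weight u h [set z; u]%SET ->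
  weight z (u :: h) = c * weight u h.
Proof.
move=> hc; rewrite /weight (bigD1 [set z; u]%SET) //= hc.
rewrite [X in _ = _ * X](bigD1 [set z; u]%SET) //= mulrA; congr (_ * _).
apply: eq_bigr => e ne; rewrite /edge_weight /mult /= [_ == e]eq_sym (negPf ne) add0n.
by case: (z \in _); rewrite // inE (negPf ne).
Qed.

Lemma weight_new u h z : z \notin u :: h ->
  weight z (u :: h) = s [set z; u]%SET * weight u h.
Proof.
move=> zh; apply: weight_step; rewrite /edge_weight.
have eN : [set z; u]%SET \notin trail u h.
  by apply/negP => /trail_visited/(_ (set21 z u)); rewrite (negPf zh).
have -> : ([set z; u]%SET \in tree u h) = false.
  by apply: contraNF eN => /tree_sub_trail.
have m0 : mult u h [set z; u]%SET = 0%N by apply/count_memPn.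
by rewrite m0 /mult /= (negPf zh) inE eqxx /= -/(mult u h _) m0.
Qed.

Lemma weight_back u h z : opened u h [set z; u]%SET ->
  weight z (u :: h) = weight u h.
Proof.
move=> /andP[tr /eqP m1]; rewrite -[RHS]mul1r; apply: weight_step.
have zh : z \in u :: h.
  exact: (trail_visited (tree_sub_trail tr) (set21 z u)).
rewrite mul1r /edge_weight m1 {1}/mult /= zh eqxx tr.
by rewrite -/(mult u h _) m1.
Qed.

Lemma weight_jump u h z : z \in u :: h -> ~~ opened u h [set z; u]%SET ->
  weight z (u :: h) = kappa * weight u h.
Proof.
move=> zh opN; apply: weight_step.
rewrite /edge_weight {1 2}/mult /= zh eqxx add1n -/(mult u h _).
case: ifP => tr; last by rewrite exprS.
move: opN (tree_mult_gt0 tr); rewrite /opened tr /=.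
case: (mult _ _ _) => [|[|m]] // _ _.
by rewrite !subSS !subn0 exprS mulrCA.
Qed.

Let cost u h : R := weight u h * (potential u (opened u h))%:R.

(** The moves to a new vertex and the moves back contribute at most [cost u h]
    each; this is the 2.  The jumps contribute a factor [(size h).+1] for the
    choice of [z] and another one for the growth of the potential. *)
Lemma cost_step u h :
  \sum_z cost z (u :: h) <= (2 + kappa * (size h).+1%:R ^+ 2) * cost u h.
Proof.
have c0 : 0 <= cost u h by rewrite mulr_ge0 ?weight_ge0 ?ler0n.
pose bck z := opened u h [set z; u]%SET.
(* The three summands bound the moves to new vertices, the moves back and the
   jumps. *)
apply: (@le_trans _ _ (\sum_z
  (s [set z; u]%SET * cost u h +
   (bck z)%:R * (weight u h * (potential z (opened z (u :: h)))%:R) +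
   (z \in u :: h)%:R * (kappa * ((size h).+1%:R * cost u h))))).
  apply: ler_sum => z _.
  have t1 : 0 <= s [set z; u]%SET * cost u h by rewrite mulr_ge0.
  have t3 : 0 <= (z \in u :: h)%:R * (kappa * ((size h).+1%:R * cost u h)).
    by rewrite mulr_ge0 ?ler0n // mulr_ge0 // mulr_ge0 ?ler0n.
  have t2 : 0 <= (bck z)%:R * (weight u h * (potential z (opened z (u :: h)))%:R).
    by rewrite mulr_ge0 ?ler0n // mulr_ge0 ?weight_ge0 ?ler0n.
  move: t1 t2 t3; have [zh|zh] := boolP (z \in u :: h); last first.
    move=> _ t2 _; rewrite [leLHS]/cost weight_new // [in leLHS]potential_new //.
    by rewrite -mulrA -/(cost u h) mul0r addr0 lerDl.
  have [op|opN] := boolP (bck z) => t1 t2 t3.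
    rewrite -[leLHS]add0r -[leLHS]addr0 lerD // lerD //.
    by rewrite /cost weight_back // mul1r.
  rewrite mul0r addr0 mul1r -[leLHS]add0r lerD //.
  rewrite /cost weight_jump // -mulrA ler_wpM2l // [leRHS]mulrCA ler_wpM2l ?weight_ge0 //.
  rewrite -natrM ler_nat mulnC.
  exact: potential_jump.
rewrite !big_split /= -!mulr_suml !mulrDl.
have b1 : (\sum_z s [set z; u]%SET) * cost u h <= cost u h.
  by rewrite -[leRHS]mul1r ler_wpM2r.
have b2 : \sum_z (bck z)%:R * (weight u h * (potential z (opened z (u :: h)))%:R) <= cost u h.
  under eq_bigr do rewrite mulrCA.
  rewrite -mulr_sumr /cost ler_wpM2l ?weight_ge0 //.
  set v := valence (opened u h) u.
  have vE : \sum_z (bck z)%:R = v%:R :> R.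
    rewrite -natr_sum; congr (_%:R); rewrite sum_indicator.
    by apply: eq_card => z; rewrite !inE finset.setUC.
  have [v0|v0] := posnP v.
    rewrite big1 ?ler0n // => z _.
    suff -> : bck z = false by rewrite mul0r.
    move: vE; rewrite v0 => /eqP; rewrite psumr_eq0 // => /allP/(_ z (mem_index_enum _)).
    by rewrite /= pnatr_eq0 eqb0 => /negbTE.
  rewrite -(@ler_pM2r _ v%:R) ?ltr0n // mulr_suml.
  apply: (@le_trans _ _ (\sum_z (bck z)%:R * (potential u (opened u h))%:R)).
    apply: ler_sum => z _; have [op|_] := boolP (bck z); last by rewrite !mul0r.
    by rewrite !mul1r -natrM ler_nat potential_back.
  by rewrite -mulr_suml vE mulrC.
have b3 : (\sum_z (z \in u :: h)%:R) * (kappa * ((size h).+1%:R * cost u h)) <=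
    kappa * (size h).+1%:R ^+ 2 * cost u h.
  rewrite mulrCA -mulrA ler_wpM2l // mulrA expr2 ler_wpM2r // ler_wpM2r //.
  by rewrite -natr_sum ler_nat (sum_indicator (mem (u :: h))) (card_size (u :: h)).
by rewrite !mul1r !lerD.
Qed.

Variables (T : Type) (Ex : (T -> R) -> R) (X : T -> {set 'I_n} -> R).
Hypothesis eq_Ex : forall f g, f =1 g -> Ex f = Ex g.
Hypothesis Ex_sum : forall f : 'I_n -> T -> R,
  Ex (fun S => \sum_z f z S) = \sum_z Ex (f z).
Hypothesis Ex_cst : Ex (fun=> 0) = 0.
Hypothesis Ex_monomial : forall l : seq {set 'I_n},
  Ex (fun S => \prod_(e <- l) X S e) = \prod_e mom e (count_mem e l).

Definition random_mx S : 'M[R]_n := \matrix_(i, j) X S [set i; j]%SET.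

(** Expanding one factor of the matrix power extends the walk by one step, so the
    sum over walks never has to be written down. *)
Lemma walk_bound L t u h v : (size h + t <= L)%N ->
  `|Ex (fun S => \prod_(e <- trail u h) X S e * (random_mx S ^+ t) u v)| <=
  (2 + kappa * L.+1%:R ^+ 2) ^+ t * cost u h.
Proof.
elim: t u h => [|t IH] u h hL.
  rewrite expr0 mul1r.
  have c0 : 0 <= cost u h by rewrite mulr_ge0 ?weight_ge0 ?ler0n.
  have [uv|uv] := eqVneq u v; last first.
    rewrite (_ : Ex _ = 0) ?normr0 // -[RHS]Ex_cst; apply: eq_Ex => S.
    by rewrite (_ : random_mx S ^+ 0 = 1%:M) // mxE (negPf uv) mulr0.
  rewrite (_ : Ex _ = \prod_e mom e (mult u h e)); last first.
    rewrite -[RHS]Ex_monomial; apply: eq_Ex => S.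
    by rewrite (_ : random_mx S ^+ 0 = 1%:M) // mxE uv eqxx mulr1.
  apply: (le_trans (moment_le_weight u h)); rewrite /cost ler_peMr ?weight_ge0 //.
  by rewrite ler1n potential_gt0.
rewrite (_ : Ex _ = \sum_z Ex (fun S =>
   \prod_(e <- trail z (u :: h)) X S e * (random_mx S ^+ t) z v)); last first.
  rewrite -Ex_sum; apply: eq_Ex => S.
  rewrite exprS -[_ * _ ^+ t]/(_ *m _) [in LHS]mxE mulr_sumr; apply: eq_bigr => z _.
  by rewrite /= big_cons mulrA [in LHS]mxE finset.setUC [_ * X S _]mulrC.
apply: (le_trans (ler_norm_sum _ _ _)).
have hL' : (size (u :: h) + t <= L)%N by rewrite addSnnS.
apply: le_trans (ler_sum _ (fun z _ => IH z (u :: h) hL')) _.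
have B0 m : 0 <= 2 + kappa * m%:R ^+ 2 :> R by rewrite addr_ge0 // mulr_ge0 // exprn_ge0.
rewrite -mulr_sumr [X in _ <= X * _]exprSr -[leRHS]mulrA ler_wpM2l ?exprn_ge0 //.
apply: (le_trans (cost_step u h)); rewrite ler_wpM2r //.
  by rewrite mulr_ge0 ?weight_ge0 ?ler0n.
rewrite lerD2l ler_wpM2l // ler_pXn2r ?nnegrE // ler_nat ltnS.
by apply: leq_trans hL; rewrite leq_addr.
Qed.

Theorem expected_trace_le L :
  Ex (fun S => \tr (random_mx S ^+ L)) <=
  n%:R * (2 + kappa * L.+1%:R ^+ 2) ^+ L.
Proof.
rewrite Ex_sum.
apply: (@le_trans _ _ (\sum_(u < n) (2 + kappa * L.+1%:R ^+ 2) ^+ L)); last first.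
  by rewrite sumr_const card_ord mulr_natl.
apply: ler_sum => u _.
have := @walk_bound L L u [::] u (leqnn L).
rewrite (_ : cost u [::] = 1) ?mulr1; last first.
  rewrite /cost /weight /potential /edge_weight big1 => [|e _]; last by [].
  have v0 y : valence (opened u [::]) y = 0%N.
    by apply: eq_card0 => z; rewrite !inE.
  by rewrite v0 big1 ?mulr1 // => y _; rewrite v0.
move=> h; apply: le_trans (ler_norm _) (le_trans _ h).
rewrite le_eqVlt; apply/orP; left; apply/eqP; congr (`|_|).
by apply: eq_Ex => S; rewrite big_nil mul1r.
Qed.

End TraceBound.

(** * Moments of the percolation noise *)

Section Edges.
Variables (n : nat) (G : graph n).

Lemma edges_set2 i j : ([set i; j]%SET \in edges G) = G i j.
Proof.
apply/imsetP/idP => [[[a b]]|Gij]; last by exists (i, j); rewrite // inE.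
rewrite inE /= => Gab e.
have ab : a != b by apply: contraTneq Gab => ->; rewrite adj_irr.
have ij : i != j.
  by have := congr1 (fun A : {set 'I_n} => #|A|) e; rewrite !cards2 ab; case: (i != j).
have := set21 i j; rewrite e !inE => /orP[]/eqP ai.
  by move: e; rewrite ai => /eqP; rewrite set2_inj => /eqP ->.
by move: e; rewrite ai [RHS]finset.setUC => /eqP; rewrite set2_inj => /eqP ->; rewrite adj_sym.
Qed.

Lemma edges_incident i :
  [set e in edges G | i \in e]%SET = [set [set i; j]%SET | j in [set j | G i j]%SET]%SET.
Proof.
apply/setP => e; rewrite !inE; apply/andP/imsetP => [[/imsetP[[a b]]]|[j]].
  rewrite inE /= => Gab ->; rewrite !inE => /orP[]/eqP ->.
    by exists b; rewrite ?inE.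
  by exists a; rewrite ?inE 1?adj_sym // finset.setUC.
by rewrite inE => Gij ->; rewrite edges_set2 Gij set21.
Qed.

Lemma big_incident (R : Type) (idx : R) (op : Monoid.com_law idx) i (F : {set 'I_n} -> R) :
  \big[op/idx]_(e in edges G | i \in e) F e = \big[op/idx]_(j | G i j) F [set i; j]%SET.
Proof.
transitivity (\big[op/idx]_(e in [set e in edges G | i \in e]%SET) F e).
  by apply: eq_bigl => e; rewrite inE.
rewrite edges_incident big_imset /=; last first.
  by move=> j k _ _ /eqP; rewrite set2_inj => /eqP.
by apply: eq_bigl => j; rewrite inE.
Qed.
End Edges.

Section CenteredMoments.
Variables (R : realFieldType) (T : finType) (E : {set T}) (p : R).
Hypothesis p01 : 0 <= p <= 1.
Local Notation x := (centered E p).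
Local Notation Ex := (expect E p).

Lemma expect_monomial0 (l : seq T) a : count_mem a l = 1%N ->
  Ex (fun S => \prod_(e <- l) x S e) = 0.
Proof. by move=> c1; rewrite expect_monomial (bigD1 a) //= c1 moment1 mul0r. Qed.

Lemma expect_centered2 a b :
  `|Ex (fun S => x S a * x S b)| <= (a == b)%:R * ((a \in E)%:R * p).
Proof.
rewrite (_ : Ex _ = Ex (fun S => \prod_(e <- [:: a; b]) x S e)); last first.
  by apply: eq_expect => S _; rewrite !big_cons big_nil mulr1.
have [<-|ab] := eqVneq a b; last first.
  rewrite (@expect_monomial0 _ a) ?normr0 ?mul0r //=.
  by rewrite eqxx eq_sym (negPf ab).
rewrite mul1r expect_monomial (bigD1 a) //= big1 => [|e ea]; last first.
  by rewrite ![a == e]eq_sym (negPf ea) moment0.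
by rewrite mulr1 eqxx moment_le.
Qed.

(** An edge that occurs once among [a], [b], [c], [d] makes the mean vanish; hence
    the pairs [a, b] and [c, d] must coincide. *)
Lemma expect_centered4 a b c d : a != b -> c != d ->
  `|Ex (fun S => (x S a * x S b) * (x S c * x S d))| <=
  (((c == a) && (d == b))%:R + ((c == b) && (d == a))%:R) *
  (((a \in E)%:R * p) * ((b \in E)%:R * p)).
Proof.
move=> ab cd.
rewrite (_ : Ex _ = Ex (fun S => \prod_(e <- [:: a; b; c; d]) x S e)); last first.
  by apply: eq_expect => S _; rewrite !big_cons big_nil mulr1 !mulrA.
have p0 : 0 <= p by case/andP: p01.
set B := (_ + _) * _.
have B0 : 0 <= B by rewrite !mulr_ge0 // addr_ge0.
have [|aN] := boolP (a \in [:: c; d]); last first.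
  move: aN; rewrite !inE negb_or => /andP[ac ad].
  rewrite (@expect_monomial0 _ a) ?normr0 //=.
  by rewrite eqxx [b == a]eq_sym (negPf ab) [c == a]eq_sym (negPf ac) [d == a]eq_sym (negPf ad).
have [|bN] := boolP (b \in [:: c; d]); last first.
  move: bN; rewrite !inE negb_or => /andP[bc bd] _.
  rewrite (@expect_monomial0 _ b) ?normr0 //=.
  by rewrite eqxx (negPf ab) [c == b]eq_sym (negPf bc) [d == b]eq_sym (negPf bd).
move=> bI aI.
have val : `|Ex (fun S => \prod_(e <- [:: a; b; a; b]) x S e)| <=
    ((a \in E)%:R * p) * ((b \in E)%:R * p).
  have ba : b != a by rewrite eq_sym.
  rewrite expect_monomial (bigD1 a) //= (bigD1 b) //= big1 => [|e /andP[ea eb]]; last first.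
    by rewrite ![a == e]eq_sym ![b == e]eq_sym (negPf ea) (negPf eb) moment0.
  rewrite !eqxx (negPf ab) (negPf ba) mulr1 normrM /=.
  by rewrite ler_pM ?normr_ge0 ?moment_le.
have -> : Ex (fun S => \prod_(e <- [:: a; b; c; d]) x S e) =
    Ex (fun S => \prod_(e <- [:: a; b; a; b]) x S e).
  apply: eq_expect => S _; apply: perm_big.
  apply: (@perm_cat _ [:: a; b] [:: a; b] [:: c; d] [:: a; b]) => //.
  move: aI bI; rewrite !inE => /orP[/eqP ac|/eqP ad] /orP[/eqP bc|/eqP bd].
  - by rewrite ac bc eqxx in ab.
  - by rewrite ac bd.
  - by rewrite ad bc; apply/seq.permP => q /=; rewrite !addn0 addnC.
  - by rewrite ad bd eqxx in ab.
apply: (le_trans val); rewrite /B ler_peMl ?mulr_ge0 //.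
move: aI bI; rewrite !inE => /orP[/eqP ac|/eqP ad] /orP[/eqP bc|/eqP bd].
- by rewrite ac bc eqxx in ab.
- by rewrite -ac -bd !eqxx lerDl.
- by rewrite -ad -bc !eqxx lerDr.
- by rewrite ad bd eqxx in ab.
Qed.
End CenteredMoments.

(** From [expR (- x) >= 1 - x] and
    [(1 - x) (1 + x + 2 x^2) = 1 + x^2 (1 - 2 x)]. *)
Lemma expR_le_quadratic (R : realType) (x : R) : x <= 2^-1 ->
  expR x <= 1 + x + 2 * x ^+ 2.
Proof.
move=> x2; have x1 : 0 < 1 - x by lra.
have : expR x <= (1 - x)^-1.
  by rewrite -[x in leLHS]opprK expRN lef_pV2 ?posrE ?expR_gt0 // expR_ge1Dx.
move=> /le_trans; apply; rewrite -[leLHS]mul1r ler_pdivrMr //.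
have : 0 <= x ^+ 2 * (1 - 2 * x) by rewrite mulr_ge0 ?sqr_ge0; lra.
nra.
Qed.

Section Percolation.
Variables (R : realType) (n : nat) (G : graph n) (p : R).
Hypothesis p01 : 0 <= p <= 1.
Implicit Type S : {set {set 'I_n}}.
Local Notation Ex := (expect (edges G) p).

Definition noise S i j : R := centered (edges G) p S [set i; j]%SET.

Definition mean_degree i : R := p * (degree G i)%:R.

Definition degree_dev S i : R := \sum_j noise S i j.

Lemma noiseE S i j : noise S i j = (spanning_subgraph G S i j)%:R - p * (G i j)%:R.
Proof.
by rewrite /noise /centered edges_set2 /= /sub_adj; case: (G i j); rewrite ?mulr1 ?mulr0 ?subr0.
Qed.

Lemma noise_sym S i j : noise S i j = noise S j i.
Proof. by rewrite /noise finset.setUC. Qed.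

Lemma noise_ii S i : noise S i i = 0.
Proof. by rewrite /noise /centered edges_set2 adj_irr. Qed.

Lemma degreeE (H : graph n) i : (degree H i)%:R = \sum_j (H i j)%:R :> R.
Proof.
rewrite -natr_sum; congr _%:R; rewrite sum_indicator.
by apply: eq_card => j; rewrite inE.
Qed.

Lemma degree_devE S i :
  degree_dev S i = (degree (spanning_subgraph G S) i)%:R - mean_degree i.
Proof.
rewrite /mean_degree !degreeE mulr_sumr -sumrB.
by apply: eq_bigr => j _; rewrite noiseE.
Qed.

(** Chernoff's bound; [s] may be negative, which gives the lower tail. *)
Lemma degree_mgf i s : s <= 2^-1 ->
  Ex (fun S => expR (s * degree_dev S i)) <= expR (2 * s ^+ 2 * mean_degree i).
Proof.
move=> s2; have [p0 p1] : 0 <= p /\ p <= 1 by apply/andP.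
pose f (e : {set 'I_n}) (b : bool) : R :=
  if (e \in edges G) && (i \in e) then expR (s * (b%:R - p)) else 1.
have -> : Ex (fun S => expR (s * degree_dev S i)) =
    Ex (fun S => \prod_e f e (e \in S)).
  apply: eq_expect => S _; rewrite /degree_dev mulr_sumr expR_sum.
  have -> : \prod_j expR (s * noise S i j) = \prod_(j | G i j) expR (s * noise S i j).
    rewrite [RHS]big_mkcond; apply: eq_bigr => j _; case: ifPn => // Gij.
    by rewrite /noise /centered edges_set2 (negPf Gij) mulr0 expR0.
  rewrite -(@big_incident _ G _ _ _ i (fun e => expR (s * centered (edges G) p S e))).
  rewrite big_mkcond; apply: eq_bigr => e _; rewrite /f.
  by case: ifP => // /andP[eE _]; rewrite /centered eE.
rewrite expect_prod.
have -> : 2 * s ^+ 2 * mean_degree i = \sum_(j | G i j) 2 * s ^+ 2 * p.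
  rewrite /mean_degree degreeE [RHS]big_mkcond mulrA mulr_sumr; apply: eq_bigr => j _.
  by case: (G i j); rewrite ?mulr1 ?mulr0.
rewrite -(@big_incident _ G _ _ _ i (fun=> 2 * s ^+ 2 * p)) expR_sum.
rewrite [leRHS]big_mkcond; apply: ler_prod => e _.
rewrite /f; case: (e \in edges G); last by rewrite ler01 lexx.
case: (i \in e); last by rewrite /= !mulr1 addrC subrK ler01 lexx.
rewrite /=.
apply/andP; split; first by rewrite addr_ge0 // mulr_ge0 ?expR_ge0 // subr_ge0.
have -> : p * expR (s * (1 - p)) + (1 - p) * expR (s * (0 - p)) =
    expR (- (s * p)) * (1 + p * (expR s - 1)).
  by rewrite sub0r mulrN mulrBr mulr1 expRD; ring.
apply: (@le_trans _ _ (expR (- (s * p)) * expR (p * (expR s - 1)))).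
  by rewrite ler_wpM2l ?expR_ge0 // expR_ge1Dx.
rewrite -expRD ler_expR.
have := ler_wpM2l p0 (expR_le_quadratic s2); lra.
Qed.

(** The part of the square of a degree deviation that is a sum of uncorrelated
    products. *)
Definition pair_noise S i : R :=
  \sum_j \sum_(k | k != j) noise S i j * noise S i k.

(** The diagonal terms are linear in the degree deviation, because the square
    of a centred Bernoulli variable is an affine function of it. *)
Lemma pair_noiseE S i : S \subset edges G ->
  degree_dev S i ^+ 2 =
  pair_noise S i + (1 - 2 * p) * degree_dev S i + (1 - p) * mean_degree i.
Proof.
move=> SE; rewrite /mean_degree degreeE expr2 {1 2}/degree_dev big_distrlr /=.
rewrite -addrA /pair_noise /degree_dev !mulr_sumr -!big_split /=; apply: eq_bigr => j _.
rewrite (bigD1 j) //= addrC; congr (_ + _).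
rewrite noiseE /= /sub_adj; case: (G i j) => /=; last by ring.
by case: (_ \in S) => /=; ring.
Qed.

Lemma noise_distinct (i j k : 'I_n) : k != j -> [set i; j]%SET != [set i; k]%SET.
Proof. by rewrite set2_inj eq_sym. Qed.

Lemma sum_pair_indicator (a b : 'I_n) :
  \sum_(i < n) \sum_(j < n) ((i == a) && (j == b))%:R = 1 :> R.
Proof.
rewrite (bigD1 a) //= (bigD1 b) //= !eqxx big1 => [|j /negPf ->]; last by rewrite andbF.
by rewrite addr0 big1 ?addr0 // => i /negPf ->; rewrite big1.
Qed.

(** Two distinct edges that meet determine their common vertex, so pairs of edges at
    different vertices never coincide. *)
Lemma pair_noise_cov i l :
  `|Ex (fun S => pair_noise S i * pair_noise S l)| <=
  (i == l)%:R * (2 * mean_degree i ^+ 2).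
Proof.
have p0 : 0 <= p by case/andP: p01.
pose g j : R := (G i j)%:R * p.
have g0 j : 0 <= g j by rewrite mulr_ge0.
pose c (j k j' k' : 'I_n) : R := ((([set l; j'] == [set i; j]) && ([set l; k'] == [set i;
  k]))%SET)%:R +
  ((([set l; j'] == [set i; k]) && ([set l; k'] == [set i; j]))%SET)%:R.
have -> : Ex (fun S => pair_noise S i * pair_noise S l) =
  \sum_j \sum_(k | k != j) \sum_j' \sum_(k' | k' != j')
    Ex (fun S => (noise S i j * noise S i k) * (noise S l j' * noise S l k')).
  transitivity (Ex (fun S => \sum_j \sum_(k | k != j) \sum_j' \sum_(k' | k' != j')
    ((noise S i j * noise S i k) * (noise S l j' * noise S l k')))).
    apply: eq_expect => S _; rewrite /pair_noise mulr_suml; apply: eq_bigr => j _.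
    rewrite mulr_suml; apply: eq_bigr => k _; rewrite mulr_sumr; apply: eq_bigr => j' _.
    by rewrite mulr_sumr.
  rewrite expect_sum; apply: eq_bigr => j _; rewrite expect_sum; apply: eq_bigr => k _.
  by rewrite expect_sum; apply: eq_bigr => j' _; rewrite expect_sum.
apply: (@le_trans _ _ (\sum_j \sum_(k | k != j) \sum_j' \sum_(k' | k' != j') c j k j' k' * (g j
  * g k))).
  apply: (le_trans (ler_norm_sum _ _ _)); apply: ler_sum => j _.
  apply: (le_trans (ler_norm_sum _ _ _)); apply: ler_sum => k kj.
  apply: (le_trans (ler_norm_sum _ _ _)); apply: ler_sum => j' _.
  apply: (le_trans (ler_norm_sum _ _ _)); apply: ler_sum => k' kj'.
  by have := expect_centered4 (edges G) p01 (noise_distinct i kj) (noise_distinct l kj');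
    rewrite !edges_set2.
have [il|il] := eqVneq i l; last first.
  rewrite mul0r big1 // => j _; rewrite big1 // => k kj; rewrite big1 // => j' _.
  rewrite big1 // => k' kj'.
  suff -> : c j k j' k' = 0 by rewrite mul0r.
  have N (a b a' b' : 'I_n) : b != a ->
      (([set l; a'] == [set i; a]) && ([set l; b'] == [set i; b]))%SET = false.
    move=> ba; apply/negP => /andP[/eqP e1 /eqP e2].
    have := set21 l a'; have := set21 l b'; rewrite e1 e2 !inE ![l == i]eq_sym (negPf il) /=.
    by move=> /eqP lb /eqP la; rewrite -lb -la eqxx in ba.
  by rewrite /c N // N 1?eq_sym // addr0.
subst l; rewrite mul1r.
apply: (@le_trans _ _ (\sum_j \sum_k 2 * (g j * g k))).
  apply: ler_sum => j _; rewrite big_mkcond; apply: ler_sum => k _.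
  case: ifP => kj; last by rewrite !mulr_ge0.
  under eq_bigr do rewrite -mulr_suml.
  rewrite -mulr_suml ler_wpM2r ?mulr_ge0 //.
  apply: (@le_trans _ _ (\sum_j' \sum_k' (((j' == j) && (k' == k))%:R + ((j' == k) && (k' ==
    j))%:R))).
    apply: ler_sum => j' _; rewrite big_mkcond; apply: ler_sum => k' _.
    by case: ifP => _; rewrite ?addr_ge0 // /c !set2_inj.
  under eq_bigr do rewrite big_split /=.
  by rewrite big_split /= !sum_pair_indicator.
rewrite le_eqVlt; apply/orP; left; apply/eqP.
under eq_bigr do rewrite -mulr_sumr; rewrite -mulr_sumr; congr (_ * _).
have -> : mean_degree i = \sum_j g j by rewrite /mean_degree degreeE mulr_sumr; apply: eq_bigr
  => j _; rewrite mulrC.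
by rewrite expr2 big_distrlr.
Qed.

Lemma pair_noise_sum_var (om : 'I_n -> R) :
  Ex (fun S => (\sum_i om i * pair_noise S i) ^+ 2) <=
  \sum_i om i ^+ 2 * (2 * mean_degree i ^+ 2).
Proof.
have -> : Ex (fun S => (\sum_i om i * pair_noise S i) ^+ 2) =
   \sum_i \sum_l om i * om l * Ex (fun S => pair_noise S i * pair_noise S l).
  transitivity (Ex (fun S => \sum_i \sum_l om i * om l * (pair_noise S i * pair_noise S l))).
    apply: eq_expect => S _; rewrite expr2 big_distrlr /=.
    by apply: eq_bigr => i _; apply: eq_bigr => l _; ring.
  rewrite expect_sum; apply: eq_bigr => i _; rewrite expect_sum; apply: eq_bigr => l _.
  by rewrite expectZ.
apply: ler_sum => i _; rewrite (bigD1 i) //= big1 => [|l li]; last first.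
  have := pair_noise_cov i l; rewrite eq_sym (negPf li) mul0r normr_le0 => /eqP ->.
  by rewrite mulr0.
rewrite addr0 -expr2 ler_wpM2l ?sqr_ge0 //.
by have := pair_noise_cov i i; rewrite eqxx mul1r; apply: le_trans (ler_norm _).
Qed.

Lemma pair_noise_var i : Ex (fun S => pair_noise S i ^+ 2) <= 2 * mean_degree i ^+ 2.
Proof.
have := pair_noise_cov i i; rewrite eqxx mul1r; apply: le_trans.
by apply: le_trans (ler_norm _).
Qed.

Lemma degree_dev_sum_var (om : 'I_n -> R) (c : R) :
  (forall i, 0 <= om i <= c) ->
  Ex (fun S => (\sum_i om i * degree_dev S i) ^+ 2) <=
  2 * c * \sum_i om i * mean_degree i.
Proof.
move=> omc; have p0 : 0 <= p by case/andP: p01.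
have om0 i : 0 <= om i by case/andP: (omc i).
have -> : Ex (fun S => (\sum_i om i * degree_dev S i) ^+ 2) =
   \sum_i \sum_j \sum_l \sum_m om i * om l * Ex (fun S => noise S i j * noise S l m).
  transitivity (Ex (fun S => \sum_i \sum_j \sum_l \sum_m om i * om l * (noise S i j * noise S l
    m))).
    apply: eq_expect => S _; rewrite expr2 mulr_suml; apply: eq_bigr => i _.
    rewrite -mulrA /degree_dev mulr_suml mulr_sumr; apply: eq_bigr => j _.
    rewrite mulr_sumr mulr_sumr; apply: eq_bigr => l _.
    by rewrite !mulr_sumr; apply: eq_bigr => m _; ring.
  rewrite expect_sum; apply: eq_bigr => i _; rewrite expect_sum; apply: eq_bigr => j _.
  rewrite expect_sum; apply: eq_bigr => l _; rewrite expect_sum; apply: eq_bigr => m _.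
  by rewrite expectZ.
rewrite mulr_sumr; apply: ler_sum => i _.
have -> : 2 * c * (om i * mean_degree i) = \sum_j 2 * c * (om i * ((G i j)%:R * p)).
  rewrite -!mulr_sumr /mean_degree degreeE; congr (_ * (_ * _)).
  by rewrite mulrC mulr_suml.
apply: ler_sum => j _.
apply: (@le_trans _ _ (\sum_l \sum_m (((l == i) && (m == j))%:R + ((l == j) && (m == i))%:R) *
    (c * (om i * ((G i j)%:R * p))))).
  apply: ler_sum => l _; apply: ler_sum => m _.
  have h : Ex (fun S => noise S i j * noise S l m) <=
      (([set i; j] == [set l; m])%SET)%:R * ((G i j)%:R * p).
    by have := expect_centered2 (edges G) p01 [set i; j]%SET [set l; m]%SET;
      rewrite edges_set2; apply: le_trans (ler_norm _).
  apply: (le_trans (ler_wpM2l (mulr_ge0 (om0 i) (om0 l)) h)).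
  set q := (G i j)%:R * p; set b := (_ == _)%:R.
  have -> : om i * om l * (b * q) = b * (om l * (om i * q)) by ring.
  have e : ((([set i; j] == [set l; m])%SET)%:R : R) <=
      ((l == i) && (m == j))%:R + ((l == j) && (m == i))%:R.
    case: eqP => // /eqP e; last by rewrite addr_ge0.
    have := set21 l m; rewrite -(eqP e) !inE => /orP[] /eqP li.
      by move: e; rewrite li set2_inj => /eqP ->; rewrite !eqxx lerDl.
    by move: e; rewrite li finset.setUC set2_inj => /eqP ->; rewrite !eqxx lerDr.
  have q0 : 0 <= om i * q by rewrite !mulr_ge0.
  apply: ler_pM => //; first by rewrite mulr_ge0.
  by rewrite ler_wpM2r //; case/andP: (omc l).
under eq_bigr do rewrite -mulr_suml big_split /=.
by rewrite -mulr_suml big_split /= !sum_pair_indicator; lra.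
Qed.
End Percolation.

(** * Norm of the normalised noise, and rescaling of a symmetric matrix *)

Section PercolationTrace.
Variables (R : realType) (n : nat) (G : graph n) (p dm : R).
Hypothesis p01 : 0 <= p <= 1.
Hypothesis dm_le : forall i, dm <= (degree G i)%:R.
Hypothesis pd_gt0 : 0 < p * dm.
Implicit Type S : {set {set 'I_n}}.
Local Notation Ex := (expect (edges G) p).
Local Notation t := (mean_degree G p).

Definition normalized_noise S : 'M[R]_n :=
  \matrix_(i, j) (noise G p S i j / (Num.sqrt (t i) * Num.sqrt (t j))).

Lemma retention_gt0 : 0 < p.
Proof. by rewrite lt_def; case/andP: p01 => -> _; rewrite andbT; apply: contraTneq pd_gt0 =>
  ->; rewrite mul0r ltxx. Qed.

Lemma mean_degree_ge i : p * dm <= t i.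
Proof. by rewrite /mean_degree ler_pM2l ?retention_gt0. Qed.

Lemma mean_degree_gt0 i : 0 < t i.
Proof. exact: lt_le_trans (mean_degree_ge i). Qed.

(** The entries of [sqrt D C] have size at most [1 / sqrt D], and the variances
    in row [u] add up to at most the sum over the neighbours [z] of [u] of
    [delta / (d_u d_z)], hence to at most 1. *)
Lemma normalized_noise_trace L :
  Ex (fun S => \tr ((Num.sqrt (p * dm) *: normalized_noise S) ^+ L)) <=
  n%:R * (2 + (Num.sqrt (p * dm))^-1 * L.+1%:R ^+ 2) ^+ L.
Proof.
set kappa := (Num.sqrt (p * dm))^-1.
have p0 := retention_gt0.
have k0 : 0 < kappa by rewrite invr_gt0 sqrtr_gt0.
have t0 := mean_degree_gt0.
have E0 i j : G i j -> i != j by move=> Gij; apply: contraTneq Gij => ->; rewrite adj_irr.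
pose b (e : {set 'I_n}) : R := Num.sqrt (p * dm) * \prod_(i in e) (Num.sqrt (t i))^-1.
have bE i j : i != j -> b [set i; j]%SET = Num.sqrt (p * dm) / (Num.sqrt (t i) * Num.sqrt (t j)).
  by move=> ij; rewrite /b big_setU1 ?inE //= big_set1 invfM.
have b0 e : 0 <= b e.
  by rewrite /b mulr_ge0 ?sqrtr_ge0 // prodr_ge0 // => i _; rewrite invr_ge0 sqrtr_ge0.
have sq_t i : Num.sqrt (t i) != 0 by rewrite gt_eqF // sqrtr_gt0.
have b_le e : e \in edges G -> b e <= kappa.
  case/imsetP => -[i j]; rewrite inE /= => Gij ->; rewrite bE ?E0 //.
  rewrite ler_pdivrMr ?mulr_gt0 ?sqrtr_gt0 // ler_pdivlMl ?sqrtr_gt0 //.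
  by rewrite ler_pM ?sqrtr_ge0 // ler_sqrt ?mean_degree_ge // ltW.
pose s e : R := (e \in edges G)%:R * p * b e ^+ 2.
have p1 : p <= 1 by case/andP: p01.
have := @expected_trace_le R n (fun e m => moment (edges G) p e m * b e ^+ m) s kappa
  _ _ _ (ltW k0) _ _ _ {set {set 'I_n}} Ex (fun S e => b e * centered (edges G) p S e).
set M := random_mx _.
have ME S : M S = Num.sqrt (p * dm) *: normalized_noise S.
  apply/matrixP => i j; rewrite !mxE.
  have [->|ij] := eqVneq i j.
    by rewrite noise_ii mul0r mulr0 -/(noise G p S j j) noise_ii mulr0.
  by rewrite bE // -/(noise G p S i j) mulrAC mulrA.
have -> : Ex (fun S => \tr ((Num.sqrt (p * dm) *: normalized_noise S) ^+ L)) =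
   Ex (fun S => \tr (M S ^+ L)) by apply: eq_expect => S _; rewrite ME.
apply.
- by move=> e; rewrite moment0 mul1r.
- by move=> e; rewrite moment1 mul0r.
- move=> e m; rewrite normrM [`|_ ^+ _|]ger0_norm ?exprn_ge0 // /s.
  have -> : b e ^+ m.+2 = b e ^+ 2 * b e ^+ m by rewrite -exprD.
  rewrite mulrA.
  have := @moment_le R _ (edges G) p p01 e m.+2 isT.
  case eE : (e \in edges G); rewrite ?mul0r ?mul1r => h; last first.
    by move: h; rewrite normr_le0 => /eqP ->; rewrite normr0 !mul0r.
  apply: ler_pM; rewrite ?exprn_ge0 //.
    by rewrite mulr_ge0 ?exprn_ge0.
    by rewrite ler_wpM2r ?exprn_ge0.
  by rewrite lerXn2r ?nnegrE ?b_le // ltW.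
- by move=> e; rewrite /s mulr_ge0 ?exprn_ge0 // mulr_ge0 ?ler0n ?(ltW p0).
- move=> e; rewrite /s; case eE : (e \in edges G); last by rewrite !mul0r exprn_ge0 // ltW.
  rewrite mul1r -[leRHS]mul1r ler_pM ?exprn_ge0 // ?(ltW p0) //.
  by rewrite ler_pXn2r ?nnegrE ?b_le // ltW.
- move=> u; rewrite /s.
  have d0 i : 0 < (degree G i)%:R :> R.
    by have := t0 i; rewrite /mean_degree pmulr_rgt0.
  apply: (@le_trans _ _ (\sum_z (G u z)%:R / (degree G u)%:R)).
    apply: ler_sum => z _; rewrite finset.setUC edges_set2.
    case Guz : (G u z); last by rewrite !mul0r.
    rewrite !mul1r bE ?E0 // !exprMn exprVn exprMn !sqr_sqrtr ?(ltW (t0 _)) ?(ltW pd_gt0) //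
      /mean_degree.
    have dz := d0 z; have du := d0 u; have dmz := dm_le z.
    set x := (degree G u)%:R in du *; set y := (degree G z)%:R in dz dmz *.
    have -> : p * (p * dm / (p * x * (p * y))) = (dm / y) * x^-1.
      by field; rewrite ?gt_eqF.
    by apply: ler_piMl; [rewrite invr_ge0 ltW | rewrite ler_pdivrMr // mul1r].
  by rewrite -mulr_suml -degreeE divff // gt_eqF.
- by move=> f g fg; apply: eq_expect => S _; rewrite fg.
- by move=> f; rewrite expect_sum.
- exact: expect_cst.
- move=> l; transitivity (Ex (fun S =>
      (\prod_(e <- l) b e) * \prod_(e <- l) centered (edges G) p S e)).
    by apply: eq_expect => S _; rewrite big_split.
  rewrite expectZ expect_monomial (prod_count b) -big_split /=.
  by apply: eq_bigr => e _; rewrite mulrC.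
Qed.

End PercolationTrace.

(** With [u = sqrt (1 + x)] one has [F = (1 - u) / u] and
    [F + x / 2 = (u - 1)^2 (u + 2) / (2 u)], while [x = (u - 1) (u + 1)]; the
    comparison only needs [u >= 7 / 10]. *)
Lemma inv_sqrt_expansion (R : rcfType) (x : R) : - 2^-1 <= x ->
  let F := (Num.sqrt (1 + x))^-1 - 1 in
  `|F| <= `|x| /\ `|F + x / 2| <= x ^+ 2.
Proof.
move=> x2 F; set u := Num.sqrt (1 + x).
have x1 : 0 <= 1 + x by lra.
have u2 : u ^+ 2 = 1 + x by apply: sqr_sqrtr.
have u0 : 7 / 10 <= u.
  by rewrite -(@ler_pXn2r _ 2) ?nnegrE ?sqrtr_ge0 ?u2 //; lra.
have up : 0 < u by lra.
have xE : x = (u - 1) * (u + 1) by rewrite -subr_sqr u2; ring.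
have FE : F = - (u - 1) / u by rewrite /F -/u; field; rewrite gt_eqF.
have ui : u^-1 <= 10 / 7.
  by rewrite -[leLHS]mul1r ler_pdivrMr //; lra.
have ui0 : 0 < u^-1 by rewrite invr_gt0.
have uu : u * u^-1 = 1 by rewrite divff // gt_eqF.
split.
  rewrite FE xE !normrM normrN ler_wpM2l // !gtr0_norm ?invr_gt0 //; lra.
have -> : F + x / 2 = (u - 1) ^+ 2 * ((u + 2) / (2 * u)).
  by rewrite FE xE; field; rewrite gt_eqF.
rewrite normrM ger0_norm ?sqr_ge0 // xE exprMn ler_wpM2l ?sqr_ge0 //.
rewrite ger0_norm ?divr_ge0 //; [|lra|lra].
rewrite ler_pdivrMr ?mulr_gt0 //; nra.
Qed.

Section FrobeniusPerturbation.
Variables (R : rcfType) (n : nat) (M : 'M[R]_n).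
Hypothesis M_sym : M^T = M.
Let w i := \sum_j M i j ^+ 2.

Lemma frobenius_weighted (K : 'M[R]_n) (h : 'I_n -> R) :
  (forall i j, K i j ^+ 2 <= (h i + h j) / 2 * M i j ^+ 2) ->
  \sum_i \sum_j K i j ^+ 2 <= \sum_i w i * h i.
Proof.
move=> hK.
apply: (@le_trans _ _ (\sum_i \sum_j (h i + h j) / 2 * M i j ^+ 2)).
  by apply: ler_sum => i _; apply: ler_sum => j _.
have e1 : \sum_i \sum_j h i * M i j ^+ 2 = \sum_i w i * h i.
  by apply: eq_bigr => i _; rewrite -mulr_sumr mulrC.
have e2 : \sum_i \sum_j h j * M i j ^+ 2 = \sum_i w i * h i.
  rewrite -e1 exchange_big /=; apply: eq_bigr => i _; apply: eq_bigr => j _.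
  by rewrite -[in LHS]M_sym mxE.
rewrite le_eqVlt; apply/orP; left; apply/eqP.
transitivity ((\sum_i \sum_j h i * M i j ^+ 2 + \sum_i \sum_j h j * M i j ^+ 2) / 2).
  rewrite -big_split mulr_suml /=; apply: eq_bigr => i _.
  by rewrite -big_split mulr_suml /=; apply: eq_bigr => j _; ring.
by rewrite e1 e2; field.
Qed.

(** The matrix [(1 + F) M (1 + F) - M] is the sum of the first-order part
    [- (X M + M X) / 2], which gives [sqrt Z], of its Taylor remainder, and of
    [F M F]; the last two are of second order and give [3 sqrt Y].  Bounding
    [F M F] by the maximum of [F] instead would lose a factor [sqrt (ln n)]. *)
Lemma qform_rescaling_bound (F x v : 'rV[R]_n) (Z Y : R) :
  (forall i, `|F 0 i| <= `|x 0 i|) ->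
  (forall i, `|F 0 i + x 0 i / 2| <= x 0 i ^+ 2) ->
  \sum_i w i * x 0 i ^+ 2 <= Z -> \sum_i w i * x 0 i ^+ 4 <= Y ->
  `|qform (\matrix_(i, j) (((1 + F 0 i) * (1 + F 0 j) - 1) * M i j)) v|
  <= (Num.sqrt Z + 3 * Num.sqrt Y) * sqnorm v.
Proof.
move=> F1 F2 hZ hY.
pose r i := F 0 i + x 0 i / 2.
pose A1 : 'M[R]_n := \matrix_(i, j) (- (x 0 i + x 0 j) / 2 * M i j).
pose A2 : 'M[R]_n := \matrix_(i, j) ((r i + r j) * M i j).
pose A3 : 'M[R]_n := \matrix_(i, j) (F 0 i * F 0 j * M i j).
have -> : qform (\matrix_(i, j) (((1 + F 0 i) * (1 + F 0 j) - 1) * M i j)) v =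
    qform A1 v + qform A2 v + qform A3 v.
  rewrite !qformE -!big_split /=; apply: eq_bigr => i _.
  rewrite -!big_split /=; apply: eq_bigr => j _; rewrite !mxE /r.
  by field.
have sq_le (K : 'M[R]_n) (h : 'I_n -> R) c :
    (forall i j, K i j ^+ 2 <= (h i + h j) / 2 * M i j ^+ 2) ->
    \sum_i w i * h i <= c -> `|qform K v| <= Num.sqrt c * sqnorm v.
  move=> hK hc; apply: (le_trans (qform_le_frobenius K v)).
  rewrite ler_wpM2r ?sqnorm_ge0 // ler_wsqrtr //.
  exact: le_trans (frobenius_weighted hK) hc.
have x2 i : F 0 i ^+ 2 <= x 0 i ^+ 2.
  by rewrite -real_normK ?num_real // -[leRHS]real_normK ?num_real // ler_pXn2r ?nnegrE.
have r2 i : r i ^+ 2 <= x 0 i ^+ 4.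
  by rewrite -real_normK ?num_real // (exprM _ 2 2) ler_pXn2r ?nnegrE ?sqr_ge0 ?F2.
have h1 : `|qform A1 v| <= Num.sqrt Z * sqnorm v.
  apply: (sq_le _ (fun i => x 0 i ^+ 2)) => // i j; rewrite mxE exprMn ler_wpM2r ?sqr_ge0 //.
  by have := sqr_ge0 (x 0 i - x 0 j); lra.
have h2 : `|qform A2 v| <= Num.sqrt (2 ^+ 2 * Y) * sqnorm v.
  apply: (sq_le _ (fun i => 2 ^+ 2 * x 0 i ^+ 4)) => [i j|]; last first.
    under eq_bigr do rewrite mulrCA.
    by rewrite -mulr_sumr ler_wpM2l // exprn_ge0.
  rewrite mxE exprMn ler_wpM2r ?sqr_ge0 //.
  by have := sqr_ge0 (r i - r j); have := r2 i; have := r2 j; lra.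
have h3 : `|qform A3 v| <= Num.sqrt Y * sqnorm v.
  apply: (sq_le _ (fun i => x 0 i ^+ 4)) => // i j; rewrite mxE exprMn ler_wpM2r ?sqr_ge0 //.
  rewrite exprMn; apply: (@le_trans _ _ (x 0 i ^+ 2 * x 0 j ^+ 2)).
    by rewrite ler_pM ?sqr_ge0.
  by have := sqr_ge0 (x 0 i ^+ 2 - x 0 j ^+ 2); lra.
rewrite sqrtrM ?exprn_ge0 // sqrtr_sqr normr_nat in h2.
apply: (le_trans (ler_normD _ _)); apply: (le_trans (lerD (ler_normD _ _) (lexx _))).
by lra.
Qed.
End FrobeniusPerturbation.

(** * Comparison of the two Laplacians *)

Section NormalizedAdjacency.
Variables (R : realType) (n : nat).
Implicit Type G : graph n.

Lemma laplacian_entry G i j :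
  (1%:M - laplacian R G) i j =
  (G i j)%:R / (Num.sqrt (degree G i)%:R * Num.sqrt (degree G j)%:R).
Proof.
rewrite /laplacian opprB addrC subrK /degmx_Nhalf mul_mx_diag mxE mul_diag_mx !mxE.
by rewrite invfM [RHS]mulrA [_^-1 * _]mulrC.
Qed.

(** From [2 |v_i v_j| / sqrt (d_i d_j) <= v_i^2 / d_i + v_j^2 / d_j], summed over
    the edges. *)
Lemma qform_normalized_adjacency G (v : 'rV[R]_n) :
  (forall i, 0 < degree G i)%N -> `|qform (1%:M - laplacian R G) v| <= sqnorm v.
Proof.
move=> d0; rewrite qformE.
have sd i : 0 < Num.sqrt (degree G i)%:R :> R by rewrite sqrtr_gt0 ltr0n.
pose q i := v 0 i / Num.sqrt (degree G i)%:R.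
have e1 : \sum_i \sum_j (G i j)%:R * q i ^+ 2 = sqnorm v.
  apply: eq_bigr => i _; rewrite -mulr_suml -degreeE /q exprMn exprVn sqr_sqrtr //.
  by rewrite mulrCA divff ?mulr1 // pnatr_eq0 -lt0n.
have e2 : \sum_i \sum_j (G i j)%:R * q j ^+ 2 = sqnorm v.
  rewrite -e1 exchange_big /=; apply: eq_bigr => i _; apply: eq_bigr => j _.
  by rewrite adj_sym.
apply: (@le_trans _ _ ((\sum_i \sum_j (G i j)%:R * q i ^+ 2 + \sum_i \sum_j (G i j)%:R * q j ^+
  2) / 2)); last first.
  by rewrite e1 e2; lra.
rewrite -big_split mulr_suml /=; apply: (le_trans (ler_norm_sum _ _ _)); apply: ler_sum => i _.
rewrite -big_split mulr_suml /=; apply: (le_trans (ler_norm_sum _ _ _)); apply: ler_sum => j _.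
rewrite laplacian_entry.
have -> : v 0 i * ((G i j)%:R / (Num.sqrt (degree G i)%:R * Num.sqrt (degree G j)%:R)) * v 0 j =
  (G i j)%:R * (q i * q j).
  by rewrite /q; field; rewrite !gt_eqF.
rewrite -mulrDr -mulrA normrM ger0_norm // ler_wpM2l // ler_norml.
by have := sqr_ge0 (q i + q j); have := sqr_ge0 (q i - q j); nra.
Qed.

Lemma row_sqnorm_spectral (P : 'M[R]_n) (d : 'rV[R]_n) i :
  P *m P^T = 1%:M ->
  \sum_j (P^T *m diag_mx d *m P) i j ^+ 2 = \sum_l d 0 l ^+ 2 * P l i ^+ 2.
Proof.
move=> PP; transitivity (sqnorm (row i (P^T *m diag_mx d) *m P)).
  by rewrite -row_mul; apply: eq_bigr => j _; rewrite [in RHS]mxE.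
rewrite sqnorm_orth //; apply: eq_bigr => l _.
by rewrite mxE mul_mx_diag !mxE exprMn mulrC.
Qed.

Lemma sqnorm_row_orth (P : 'M[R]_n) l : P *m P^T = 1%:M -> \sum_i P l i ^+ 2 = 1.
Proof.
move=> PP; transitivity ((P *m P^T) l l); last by rewrite PP mxE eqxx.
by rewrite [RHS]mxE; apply: eq_bigr => i _; rewrite mxE expr2.
Qed.

Lemma laplacian_dev_le1 G i : (forall i, 0 < degree G i)%N ->
  `|1 - lambda (laplacian R G) i| <= 1.
Proof.
move=> d0; have [P PP LE] := spectral_decomposition (laplacian_sym R G).
have PP' : P^T *m P = 1%:M by apply: mulmx1C.
have := qform_normalized_adjacency (row i P) d0.
have -> : sqnorm (row i P) = 1.
  by rewrite -(sqnorm_row_orth i PP); apply: eq_bigr => j _; rewrite mxE.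
suff -> : qform (1%:M - laplacian R G) (row i P) = 1 - lambda (laplacian R G) i by [].
have -> : 1%:M - laplacian R G = P^T *m diag_mx (\row_i (1 - lambda (laplacian R G) i)) *m P.
  rewrite [in LHS]LE -[1%:M in LHS]PP' -{1}[P^T]mulmx1 -mulmxBl -mulmxBr; congr (_ *m _ *m _).
  by apply/matrixP => a b; rewrite !mxE mulrnBl.
rewrite qform_diag (bigD1 i) //= big1 => [|j ji].
  by rewrite addr0 -row_mul PP !mxE eqxx expr1n mulr1.
by rewrite -row_mul PP !mxE eq_sym (negPf ji) expr0n mulr0.
Qed.

(** The rows of [M] are no longer than those of [1 - L(G)], whose square norms
    are [sum_j 1 / (d_i d_j) <= 1 / dm] over the neighbours [j] of [i]: the exceptional
    eigenvectors are spread out, which is what makes the weighted sum of squared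
    degree errors concentrate. *)
Lemma spectral_split G (nu dm : R) : 0 < dm -> 0 <= nu ->
  (forall i, dm <= (degree G i)%:R) ->
  let exc := [seq x <- spectrum (laplacian R G) | nu <= `|1 - x|] in
  exists M N : 'M[R]_n,
  [/\ 1%:M - laplacian R G = M + N, M^T = M /\ N^T = N,
      forall i, \sum_j M i j ^+ 2 <= dm^-1,
      \sum_i \sum_j M i j ^+ 2 = \sum_(x <- exc) (1 - x) ^+ 2
    & forall x y c, 0 <= c -> sqnorm x <= c ^+ 2 * sqnorm y ->
        `|(x *m N *m y^T) 0 0| <= nu * c * sqnorm y].
Proof.
move=> dm0 nu0 dmG exc; have [P PP LE] := spectral_decomposition (laplacian_sym R G).
have PP' : P^T *m P = 1%:M by apply: mulmx1C.
pose l i := lambda (laplacian R G) i.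
pose d1 : 'rV[R]_n := \row_i (if nu <= `|1 - l i| then 1 - l i else 0).
pose d2 : 'rV[R]_n := \row_i (if nu <= `|1 - l i| then 0 else 1 - l i).
have BE : 1%:M - laplacian R G = P^T *m diag_mx (d1 + d2) *m P.
  rewrite [in LHS]LE -[1%:M in LHS]PP' -{1}[P^T]mulmx1 -mulmxBl -mulmxBr; congr (_ *m _ *m _).
  apply/matrixP => a b; rewrite !mxE -mulrnBl -/(l _).
  by congr (_ *+ _); case: ifP => _; rewrite ?addr0 ?add0r.
exists (P^T *m diag_mx d1 *m P), (P^T *m diag_mx d2 *m P); split.
- by rewrite BE -mulmxDl -mulmxDr raddfD.
- by rewrite !trmx_mul !tr_diag_mx trmxK !mulmxA.
- move=> i; rewrite row_sqnorm_spectral //.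
  apply: (@le_trans _ _ (\sum_j (1%:M - laplacian R G) i j ^+ 2)).
    rewrite BE row_sqnorm_spectral //; apply: ler_sum => a _.
    rewrite ler_wpM2r ?sqr_ge0 // !mxE; case: ifP => _; rewrite ?addr0 ?add0r //.
    by rewrite expr0n sqr_ge0.
  have d0 j : 0 < (degree G j)%:R :> R by apply: lt_le_trans (dmG j).
  apply: (@le_trans _ _ (\sum_j (G i j)%:R * ((degree G i)%:R^-1 * dm^-1))).
    apply: ler_sum => j _; rewrite laplacian_entry expr_div_n exprMn !sqr_sqrtr //.
    case: (G i j); last by rewrite expr0n !mul0r.
    by rewrite expr1n !mul1r invfM ler_wpM2l ?invr_ge0 ?(ltW (d0 _)) // lef_pV2 ?posrE.
  by rewrite -mulr_suml -degreeE mulrA divff ?mul1r // gt_eqF.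
- under eq_bigr do rewrite row_sqnorm_spectral //.
  rewrite exchange_big /= /exc spectrum_lambda ?laplacian_sym // big_filter big_map
    big_enum_cond /=.
  rewrite [RHS]big_mkcond; apply: eq_bigr => i _.
  rewrite -mulr_sumr sqnorm_row_orth // mulr1 mxE -/(l i).
  by case: ifP => _; rewrite ?expr0n.
- move=> x y c c0 xy; apply: spectral_bilinear_bound => // i; rewrite mxE.
  by case: ifPn; rewrite ?normr0 // -ltNge => /ltW.
Qed.

Lemma exceptional_sum_le G (nu : R) : (forall i, 0 < degree G i)%N ->
  let exc := [seq x <- spectrum (laplacian R G) | nu <= `|1 - x|] in
  \sum_(x <- exc) (1 - x) ^+ 2 <= (size exc)%:R.
Proof.
move=> d0 /=; rewrite -sum1_size natr_sum.
rewrite spectrum_lambda ?laplacian_sym // !big_filter !big_map.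
apply: ler_sum => i _; rewrite -real_normK ?num_real // expr_le1 //.
exact: laplacian_dev_le1.
Qed.

(** [1 - L(H)] is [1 - L(G) + C] rescaled by [1 + F] on both sides; the three
    summands of the bound come from [C], [N] and [M]. *)
Lemma laplacian_comparison (G H : graph n) (p a c0 nu Z Y : R) (M N : 'M[R]_n) i :
  let t := mean_degree G p in
  let x j := ((degree H j)%:R - t j) / t j in
  0 < p -> (forall j, 0 < t j) ->
  (forall j, `|x j| <= a) -> a <= 2^-1 -> 0 <= c0 -> 0 <= nu ->
  1%:M - laplacian R G = M + N -> M^T = M -> N^T = N ->
  (forall u v c, 0 <= c -> sqnorm u <= c ^+ 2 * sqnorm v ->
        `|(u *m N *m v^T) 0 0| <= nu * c * sqnorm v) ->
  (forall v, `|qform (\matrix_(i, j) (((H i j)%:R - p * (G i j)%:R)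
      / (Num.sqrt (t i) * Num.sqrt (t j)))) v| <= c0 * sqnorm v) ->
  \sum_i (\sum_j M i j ^+ 2) * x i ^+ 2 <= Z ->
  \sum_i (\sum_j M i j ^+ 2) * x i ^+ 4 <= Y ->
  `|lambda (laplacian R H) i - lambda (laplacian R G) i| <=
  c0 * (1 + a) ^+ 2 + nu * (2 * a + a ^+ 2) + (Num.sqrt Z + 3 * Num.sqrt Y).
Proof.
move=> t x p0 t0 xa a2 c00 nu0 BE Ms Ns hN hC hZ hY.
have a0 : 0 <= a by apply: le_trans (xa i).
apply: weyl; try exact: laplacian_sym.
move=> v.
have dHE j : (degree H j)%:R = t j * (1 + x j).
  by rewrite /x; field; rewrite gt_eqF.
have x2 j : - 2^-1 <= x j.
  by have := xa j; rewrite ler_norml => /andP[]; lra.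
pose F : 'rV[R]_n := \row_j ((Num.sqrt (1 + x j))^-1 - 1).
have Fx j : `|F 0 j| <= `|x j| by rewrite mxE; case: (inv_sqrt_expansion (x2 j)).
have Fx2 j : `|F 0 j + x j / 2| <= x j ^+ 2.
  by rewrite mxE; case: (inv_sqrt_expansion (x2 j)).
have x1 j : 0 < 1 + x j by have := x2 j; lra.
pose C : 'M[R]_n := \matrix_(i, j) (((H i j)%:R - p * (G i j)%:R)
      / (Num.sqrt (t i) * Num.sqrt (t j))).
pose f : 'rV[R]_n := \row_j (v 0 j * F 0 j).
pose y := v + f.
have yE j : y 0 j = v 0 j * (1 + F 0 j) by rewrite !mxE; ring.
have entryH a' b : (1%:M - laplacian R H) a' b =
    (1 + F 0 a') * (1 + F 0 b) * ((1%:M - laplacian R G) a' b + C a' b).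
  rewrite !laplacian_entry !mxE !dHE !sqrtrM ?ltW //.
  rewrite -{3}[p]sqr_sqrtr ?ltW //.
  have tp c : (0 : R) < (degree G c)%:R by have := t0 c; rewrite /t /mean_degree pmulr_rgt0.
  by field; rewrite !gt_eqF // sqrtr_gt0.
have addE (A A' : 'M[R]_n) j k : (A + A') j k = A j k + A' j k by rewrite mxE.
have subE (A : 'M[R]_n) j k : (1%:M - A) j k = (j == k)%:R - A j k.
  by rewrite mxE [X in X + _]mxE [X in _ + X]mxE.
have -> : qform (laplacian R H) v - qform (laplacian R G) v =
    - (qform C y + (qform (\matrix_(i, j) (((1 + F 0 i) * (1 + F 0 j) - 1) * M i j)) v
      + (2 * (f *m N *m v^T) 0 0 + qform N f))).
  have fNv : (f *m N *m v^T) 0 0 = \sum_i \sum_j f 0 i * N i j * v 0 j.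
    rewrite dotE exchange_big /=; apply: eq_bigr => j _; by rewrite mxE mulr_suml.
  have fNv' : (f *m N *m v^T) 0 0 = \sum_i \sum_j v 0 i * N i j * f 0 j.
    rewrite fNv exchange_big /=; apply: eq_bigr => j _; apply: eq_bigr => j' _.
    by rewrite -[in LHS]Ns [_^T _ _]mxE; ring.
  rewrite mulr_natl mulr2n {1}fNv {1}fNv' !qformE -!big_split -!sumrN -!big_split /=.
  apply: eq_bigr => j _.
  rewrite -!big_split -!sumrN -!big_split /=; apply: eq_bigr => k _.
  have eH : laplacian R H j k = (j == k)%:R - (1 + F 0 j) * (1 + F 0 k) * (M j k + N j k + C j k).
    by have := entryH j k; rewrite BE (subE (laplacian R H)) (addE M N) => <-; ring.
  have eG : laplacian R G j k = (j == k)%:R - (M j k + N j k).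
    by rewrite -(addE M N) -BE (subE (laplacian R G)); ring.
  rewrite eH eG !yE !mxE; ring.
rewrite normrN.
have sf c : 0 <= c -> (forall j, `|F 0 j| <= c) -> sqnorm f <= c ^+ 2 * sqnorm v.
  move=> c_0 Fc; rewrite /sqnorm mulr_sumr; apply: ler_sum => j _.
  rewrite mxE exprMn mulrC ler_wpM2r ?sqr_ge0 //.
  by rewrite -real_normK ?num_real // ler_pXn2r ?nnegrE ?Fc.
have Fa j : `|F 0 j| <= a by apply: le_trans (Fx j) (xa j).
have fa := sf a a0 Fa.
have sy : sqnorm y <= (1 + a) ^+ 2 * sqnorm v.
  rewrite /sqnorm mulr_sumr; apply: ler_sum => j _.
  rewrite yE exprMn mulrC ler_wpM2r ?sqr_ge0 //.
  have := Fa j; rewrite ler_norml => /andP[l1 l2].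
  have h0 : 0 <= 1 + F 0 j by lra.
  by apply: lerXn2r; rewrite ?nnegrE ?lerD2l // addr_ge0.
have b1 : `|qform C y| <= c0 * (1 + a) ^+ 2 * sqnorm v.
  by rewrite -mulrA; apply: (le_trans (hC y)); rewrite ler_wpM2l.
have b2 := @qform_rescaling_bound _ _ M Ms F (\row_j x j) v Z Y.
have {}b2 : `|qform (\matrix_(i, j) (((1 + F 0 i) * (1 + F 0 j) - 1) * M i j)) v| <=
    (Num.sqrt Z + 3 * Num.sqrt Y) * sqnorm v.
  apply: b2 => [j|j||]; rewrite ?[(\row_j x j) 0 j]mxE //.
    by under eq_bigr do rewrite mxE.
  by under eq_bigr do rewrite mxE.
have b3 := hN f v a a0 fa.
have b4 : `|qform N f| <= nu * 1 * sqnorm f by apply: hN; rewrite // expr1n mul1r.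
have b5 : nu * 1 * sqnorm f <= nu * (a ^+ 2 * sqnorm v) by rewrite mulr1 ler_wpM2l.
apply: (le_trans (ler_normD _ _)); apply: (le_trans (lerD (lexx _) (ler_normD _ _))).
apply: (le_trans (lerD (lexx _) (lerD (lexx _) (ler_normD _ _)))).
rewrite normrM normr_nat; lra.
Qed.
End NormalizedAdjacency.

(** * Probability that the noise is well behaved *)

Section ConcentrationBound.
Variables (R : realType) (n : nat) (G : graph n) (p dm : R).
Hypothesis p01 : 0 <= p <= 1.
Hypothesis dm_le : forall i, dm <= (degree G i)%:R.
Let D := p * dm.
Hypothesis D_ge1 : 1 <= D.
Implicit Type S : {set {set 'I_n}}.
Local Notation Ex := (expect (edges G) p).
Local Notation t := (mean_degree G p).

Let D_gt0 : 0 < D. Proof. exact: lt_le_trans D_ge1. Qed.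
Let p_gt0 : 0 < p. Proof. exact: retention_gt0 p01 D_gt0. Qed.
Let dm_gt0 : 0 < dm. Proof. by move: D_gt0; rewrite /D pmulr_rgt0. Qed.
Let t_ge i : D <= t i. Proof. exact: mean_degree_ge p01 dm_le D_gt0 i. Qed.
Let t_gt0 i : 0 < t i. Proof. exact: lt_le_trans (t_ge i). Qed.
Let D_le_dm : D <= dm.
Proof. by rewrite /D ler_piMl ?(ltW dm_gt0) //; case/andP: p01. Qed.

Variables (a tau eta S2 : R) (r : nat) (w : 'I_n -> R).
Hypothesis a01 : 0 < a <= 2^-1.
Hypothesis tau_gt0 : 0 < tau.
Hypothesis eta_gt0 : 0 < eta.
Hypothesis r_gt0 : (0 < r)%N.
Hypothesis w_ge0 : forall i, 0 <= w i.
Hypothesis w_le : forall i, w i <= dm^-1.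
Hypothesis w_sum : \sum_i w i = S2.

(** For the relative degree errors [x], the first two sums carry the fluctuation
    of the sum of [w i * x i ^+ 2], and the third one bounds the sum of
    [w i * x i ^+ 4]. *)
Let pairs S : R := \sum_i w i / t i ^+ 2 * pair_noise G p S i.
Let devs S : R := \sum_i w i / t i ^+ 2 * degree_dev G p S i.
Let quartic S : R := \sum_i w i / t i ^+ 4 * pair_noise G p S i ^+ 2.

Let S2_ge0 : 0 <= S2. Proof. by rewrite -w_sum sumr_ge0. Qed.

Lemma pairs_var : Ex (fun S => pairs S ^+ 2) <= 2 * S2 / D ^+ 3.
Proof.
apply: (le_trans (pair_noise_sum_var G p01 _)).
rewrite -w_sum mulr_sumr mulr_suml; apply: ler_sum => i _.
have -> : (w i / t i ^+ 2) ^+ 2 * (2 * t i ^+ 2) = 2 * w i * (w i * (t i ^+ 2)^-1).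
  by field; rewrite gt_eqF.
apply: ler_wpM2l; first by rewrite mulr_ge0.
rewrite (exprS D 2) [(D * _)^-1]invfM; apply: ler_pM => //.
- by rewrite invr_ge0 exprn_ge0 // ltW.
- by apply: (le_trans (w_le i)); rewrite lef_pV2 ?posrE.
- by rewrite lef_pV2 ?posrE ?exprn_gt0 // lerXn2r // nnegrE ltW.
Qed.

Lemma devs_var : Ex (fun S => devs S ^+ 2) <= 2 * S2 / D ^+ 3.
Proof.
have c_ge i : 0 <= w i / t i ^+ 2 <= D^-1 / D ^+ 2.
  rewrite mulr_ge0 ?invr_ge0 ?exprn_ge0 ?(ltW (t_gt0 i)) //=.
  apply: ler_pM; rewrite ?invr_ge0 ?exprn_ge0 ?(ltW (t_gt0 i)) //.
    by apply: (le_trans (w_le i)); rewrite lef_pV2 ?posrE.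
  by rewrite lef_pV2 ?posrE ?exprn_gt0 // lerXn2r // nnegrE ltW.
apply: (le_trans (@degree_dev_sum_var R n G p p01 (fun i => w i / t i ^+ 2) _ c_ge)).
have -> : 2 * S2 / D ^+ 3 = 2 * (D^-1 / D ^+ 2) * S2.
  by field; rewrite gt_eqF.
rewrite ler_wpM2l ?mulr_ge0 ?invr_ge0 ?exprn_ge0 ?(ltW D_gt0) //.
rewrite -w_sum; apply: ler_sum => i _.
have -> : w i / t i ^+ 2 * t i = w i * (t i)^-1 by field; rewrite gt_eqF.
rewrite ler_piMr // invf_le1 //; exact: le_trans D_ge1 (t_ge i).
Qed.

Lemma quartic_mean : Ex quartic <= 2 * S2 / D ^+ 2.
Proof.
rewrite expect_sum -w_sum mulr_sumr mulr_suml; apply: ler_sum => i _.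
rewrite expectZ.
apply: (@le_trans _ _ (w i / t i ^+ 4 * (2 * t i ^+ 2))).
  rewrite ler_wpM2l ?pair_noise_var // mulr_ge0 ?invr_ge0 ?exprn_ge0 //.
  exact: ltW.
have -> : w i / t i ^+ 4 * (2 * t i ^+ 2) = 2 * w i * (t i ^+ 2)^-1.
  by field; rewrite gt_eqF.
rewrite ler_wpM2l ?mulr_ge0 //.
by rewrite lef_pV2 ?posrE ?exprn_gt0 // lerXn2r // nnegrE ltW.
Qed.

(** One summand for each requirement on the percolation: operator norm of the
    noise, maximal degree error, and the three weighted sums.  The exponential
    parameter [a / 4] minimises the exponent [2 s^2 - s a] of Chernoff's bound for
    deviations of relative size [a]. *)
Definition deviation_cost S : R :=
  \tr ((Num.sqrt D *: normalized_noise G p S) ^+ r.*2) / tau ^+ r.*2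
  + \sum_i (expR (a / 4 * degree_dev G p S i - a / 4 * a * t i)
          + expR (- (a / 4) * degree_dev G p S i - a / 4 * a * t i))
  + (pairs S * (D / eta)) ^+ 2 + (devs S * (D / eta)) ^+ 2
  + quartic S * (D / eta ^+ 2).

Lemma expected_deviation_cost : Ex deviation_cost <=
  n%:R * ((2 + (Num.sqrt D)^-1 * r.*2.+1%:R ^+ 2) / tau) ^+ r.*2
  + 2 * n%:R * expR (- (a ^+ 2 * D / 8)) + 6 * S2 / (D * eta ^+ 2).
Proof.
rewrite !expectD.
have [a0 a2] := andP a01.
have h1 : Ex (fun S => \tr ((Num.sqrt D *: normalized_noise G p S) ^+ r.*2) / tau ^+ r.*2) <=
    n%:R * ((2 + (Num.sqrt D)^-1 * r.*2.+1%:R ^+ 2) / tau) ^+ r.*2.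
  have -> : forall f : {set {set 'I_n}} -> R, Ex (fun S => f S / tau ^+ r.*2) = Ex f / tau ^+ r.*2.
    by move=> f; rewrite mulrC -expectZ; apply: eq_expect => S _; rewrite mulrC.
  rewrite expr_div_n mulrA ler_wpM2r ?invr_ge0 ?exprn_ge0 ?(ltW tau_gt0) //.
  exact: normalized_noise_trace.
have mgf i s : s <= 2^-1 -> s ^+ 2 = (a / 4) ^+ 2 ->
    Ex (fun S => expR (s * degree_dev G p S i - a / 4 * a * t i)) <= expR (- (a ^+ 2 * D / 8)).
  move=> s2 sE.
  have -> : Ex (fun S => expR (s * degree_dev G p S i - a / 4 * a * t i)) =
      expR (- (a / 4 * a * t i)) * Ex (fun S => expR (s * degree_dev G p S i)).
    by rewrite -expectZ; apply: eq_expect => S _; rewrite expRD mulrC.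
  have hm := @degree_mgf R n G p p01 i s s2.
  apply: (le_trans (ler_wpM2l (expR_ge0 _) hm)).
  (* The exponent is at most [2 (a / 4)^2 t - a^2 t / 4 = - a^2 t / 8]. *)
  rewrite -expRD ler_expR sE.
  have := t_ge i; have : 0 <= a ^+ 2 by rewrite sqr_ge0.
  by nra.
have h2 : Ex (fun S => \sum_i (expR (a / 4 * degree_dev G p S i - a / 4 * a * t i)
          + expR (- (a / 4) * degree_dev G p S i - a / 4 * a * t i))) <=
    2 * n%:R * expR (- (a ^+ 2 * D / 8)).
  rewrite expect_sum; apply: (@le_trans _ _ (\sum_(i < n) 2 * expR (- (a ^+ 2 * D / 8)))).
    apply: ler_sum => i _; rewrite expectD mulr_natl mulr2n.
    by apply: lerD; apply: mgf; rewrite ?sqrrN //; lra.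
  by rewrite sumr_const card_ord -[leLHS]mulr_natr mulrAC.
have sq (f : {set {set 'I_n}} -> R) : Ex (fun S => f S ^+ 2) <= 2 * S2 / D ^+ 3 ->
    Ex (fun S => (f S * (D / eta)) ^+ 2) <= 2 * S2 / (D * eta ^+ 2).
  move=> hf; have -> : Ex (fun S => (f S * (D / eta)) ^+ 2) = (D / eta) ^+ 2 * Ex (fun S => f S
    ^+ 2).
    by rewrite -expectZ; apply: eq_expect => S _; rewrite exprMn mulrC.
  apply: (le_trans (ler_wpM2l (sqr_ge0 _) hf)).
  by rewrite le_eqVlt; apply/orP; left; apply/eqP; field; rewrite !gt_eqF.
have h3 := sq _ pairs_var.
have h4 := sq _ devs_var.
have h5 : Ex (fun S => quartic S * (D / eta ^+ 2)) <= 2 * S2 / (D * eta ^+ 2).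
  have -> : Ex (fun S => quartic S * (D / eta ^+ 2)) = (D / eta ^+ 2) * Ex quartic.
    by rewrite -expectZ; apply: eq_expect => S _; rewrite mulrC.
  have : 0 <= D / eta ^+ 2 by rewrite divr_ge0 ?exprn_ge0 // ltW.
  move=> /ler_wpM2l /(_ _ _ quartic_mean) /le_trans; apply.
  by rewrite le_eqVlt; apply/orP; left; apply/eqP; field; rewrite !gt_eqF.
have -> : 6 * S2 / (D * eta ^+ 2) = 2 * S2 / (D * eta ^+ 2) + 2 * S2 / (D * eta ^+ 2) + 2 * S2
  / (D * eta ^+ 2).
  by rewrite -!mulrDl; congr (_ / _); ring.
by rewrite !addrA; do 4 (apply: lerD => //).
Qed.

Lemma normalized_noise_sym S : (normalized_noise G p S)^T = normalized_noise G p S.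
Proof.
apply/matrixP => i j; rewrite !mxE noise_sym.
by rewrite [Num.sqrt (t j) * _]mulrC.
Qed.

Lemma trace_even_ge0 (M : 'M[R]_n) : M^T = M -> 0 <= \tr (M ^+ r.*2).
Proof.
move=> Ms; have [P PP ->] := spectral_decomposition Ms.
rewrite spectral_expr // spectral_trace // sumr_ge0 // => i _.
by rewrite !mxE -mul2n exprM exprn_ge0 // sqr_ge0.
Qed.

Lemma deviation_cost_ge0 S : 0 <= deviation_cost S.
Proof.
have Xs : (Num.sqrt D *: normalized_noise G p S)^T = Num.sqrt D *: normalized_noise G p S.
  by rewrite linearZ /= normalized_noise_sym.
rewrite /deviation_cost !addr_ge0 ?sqr_ge0 //.
- by rewrite divr_ge0 ?trace_even_ge0 // exprn_ge0 // ltW.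
- by rewrite sumr_ge0 // => i _; rewrite addr_ge0 // expR_ge0.
- rewrite mulr_ge0 ?divr_ge0 ?exprn_ge0 ?(ltW D_gt0) ?(ltW eta_gt0) // sumr_ge0 // => i _.
  by rewrite mulr_ge0 ?sqr_ge0 // mulr_ge0 ?invr_ge0 ?exprn_ge0 // ltW.
Qed.

Lemma deviation_cost_lt1 S : S \subset edges G -> deviation_cost S < 1 ->
  let x i := ((degree (spanning_subgraph G S) i)%:R - t i) / t i in
  [/\ forall v, `|qform (normalized_noise G p S) v| <= tau / Num.sqrt D * sqnorm v,
      forall i, `|x i| <= a,
      \sum_i w i * x i ^+ 2 <= (S2 + 2 * eta) / D
    & \sum_i w i * x i ^+ 4 <= (8 * S2 / D + 2 * eta ^+ 2) / D].
Proof.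
move=> SE lt1 x; move: lt1; rewrite /deviation_cost.
have [a0 a2] := andP a01.
set q1 := _ / tau ^+ _; set q2 := \sum_i _; set q3 := (pairs S * _) ^+ 2.
set q4 := (devs S * _) ^+ 2; set q5 := quartic S * _ => lt1.
have sD : 0 < Num.sqrt D by rewrite sqrtr_gt0.
have Xs : (Num.sqrt D *: normalized_noise G p S)^T = Num.sqrt D *: normalized_noise G p S.
  by rewrite linearZ /= normalized_noise_sym.
have q1_0 : 0 <= q1 by rewrite divr_ge0 ?trace_even_ge0 // exprn_ge0 // ltW.
have q2_0 : 0 <= q2 by rewrite sumr_ge0 // => i _; rewrite addr_ge0 // expR_ge0.
have q3_0 : 0 <= q3 by rewrite sqr_ge0.
have q4_0 : 0 <= q4 by rewrite sqr_ge0.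
have t4_0 i : 0 <= w i / t i ^+ 4 by rewrite mulr_ge0 ?invr_ge0 ?exprn_ge0 // ltW.
have q5_0 : 0 <= q5.
  rewrite mulr_ge0 ?divr_ge0 ?exprn_ge0 ?(ltW D_gt0) ?(ltW eta_gt0) // sumr_ge0 // => i _.
  by rewrite mulr_ge0 ?sqr_ge0.
have xE i : x i = degree_dev G p S i / t i by rewrite /x degree_devE.
have dev i : `|degree_dev G p S i| <= a * t i.
  have q2i : expR (a / 4 * degree_dev G p S i - a / 4 * a * t i)
          + expR (- (a / 4) * degree_dev G p S i - a / 4 * a * t i) < 1.
    apply: (@le_lt_trans _ _ q2); last by lra.
    by rewrite /q2 (bigD1 i) //= lerDl sumr_ge0 //.
  have := expR_gt0 (a / 4 * degree_dev G p S i - a / 4 * a * t i).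
  have := expR_gt0 (- (a / 4) * degree_dev G p S i - a / 4 * a * t i).
  move=> e1 e2.
  have : expR (a / 4 * degree_dev G p S i - a / 4 * a * t i) < 1 by lra.
  have : expR (- (a / 4) * degree_dev G p S i - a / 4 * a * t i) < 1 by lra.
  rewrite !expR_lt1 => l1 l2.
  rewrite ler_norml; apply/andP; split; rewrite -subr_ge0 -(pmulr_rge0 _ a0); lra.
split.
- move=> v.
  have : `|qform (Num.sqrt D *: normalized_noise G p S) v| <= tau * sqnorm v.
    apply: (@qform_le_trace _ _ _ r) => //; first exact: ltW.
    rewrite -[leRHS]mul1r -ler_pdivrMr ?exprn_gt0 // -/q1; lra.
  rewrite /qform -scalemxAr -scalemxAl mxE -/(qform _ _) normrM gtr0_norm //.
  by rewrite mulrAC ler_pdivlMr // mulrC.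
- by move=> i; rewrite xE normrM normfV (gtr0_norm (t_gt0 i)) ler_pdivrMr.
- have small f : (f * (D / eta)) ^+ 2 < 1 -> `|f| <= eta / D.
    move=> f1; have : `|f * (D / eta)| < 1.
      by rewrite -(@ltr_pXn2r _ 2) ?nnegrE // expr1n real_normK ?num_real.
    rewrite normrM [`|D / eta|]gtr0_norm ?divr_gt0 // mulrA ltr_pdivrMr // mul1r => /ltW.
    by rewrite ler_pdivlMr.
  have b3 : `|pairs S| <= eta / D by apply: small; rewrite -/q3; lra.
  have b4 : `|devs S| <= eta / D by apply: small; rewrite -/q4; lra.
  have -> : \sum_i w i * x i ^+ 2 = pairs S + (1 - 2 * p) * devs S + (1 - p) * \sum_i w i / t i.
    rewrite /pairs /devs !mulr_sumr -!big_split /=; apply: eq_bigr => i _.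
    rewrite xE expr_div_n pair_noiseE //.
    by field; rewrite gt_eqF.
  have wt : \sum_i w i / t i <= S2 / D.
    rewrite -w_sum mulr_suml; apply: ler_sum => i _.
    by rewrite ler_wpM2l // lef_pV2 ?posrE.
  have wt0 : 0 <= \sum_i w i / t i by rewrite sumr_ge0 // => i _; rewrite divr_ge0 // ltW.
  have [p0 p1] := andP p01.
  have l1 : (1 - 2 * p) * devs S <= eta / D.
    apply: (le_trans (ler_norm _)); rewrite normrM -[leRHS]mul1r ler_pM //.
    by rewrite ler_norml; lra.
  have l2 : (1 - p) * \sum_i w i / t i <= S2 / D.
    by apply: le_trans wt; rewrite ler_piMl // ; lra.
  have l3 : pairs S <= eta / D by apply: le_trans b3; rewrite ler_norm.
  have -> : (S2 + 2 * eta) / D = eta / D + eta / D + S2 / D by field; rewrite gt_eqF.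
  by rewrite !lerD.
- have b5 : quartic S <= eta ^+ 2 / D.
    have : q5 <= 1 by lra.
    by rewrite /q5 mulrA ler_pdivrMr ?exprn_gt0 // mul1r ler_pdivlMr.
  apply: (@le_trans _ _ (\sum_i (8 * (w i / t i ^+ 2) + 2 * (w i / t i ^+ 4 * pair_noise G p S
    i ^+ 2)))).
    apply: ler_sum => i _; rewrite xE.
    (* The square of the degree deviation is [pair_noise G p S i + c]. *)
    pose c := (1 - 2 * p) * degree_dev G p S i + (1 - p) * t i.
    have [p0 p1] := andP p01.
    have cb : `|c| <= 2 * t i.
      apply: (le_trans (ler_normD _ _)).
      rewrite [`|(1 - 2 * p) * _|]normrM [`|(1 - p) * t i|]normrM (gtr0_norm (t_gt0 i)).
      have n1 : `|1 - 2 * p| <= 1 by rewrite ler_norml; lra.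
      have n2 : `|1 - p| <= 1 by rewrite ler_norml; lra.
      have dv : `|degree_dev G p S i| <= t i.
        by apply: (le_trans (dev i)); rewrite ler_piMl ?(ltW (t_gt0 i)) //; lra.
      have -> : 2 * t i = t i + t i by ring.
      apply: lerD.
        by rewrite -[leRHS]mul1r ler_pM.
      by rewrite ler_piMl ?(ltW (t_gt0 i)).
    have cb2 : c ^+ 2 <= 4 * t i ^+ 2.
      have -> : 4 * t i ^+ 2 = (2 * t i) ^+ 2 by ring.
      by rewrite -real_normK ?num_real // lerXn2r ?nnegrE ?mulr_ge0 ?(ltW (t_gt0 i)).
    have e4 : degree_dev G p S i ^+ 4 <= 8 * t i ^+ 2 + 2 * pair_noise G p S i ^+ 2.
      rewrite (exprM _ 2 2) pair_noiseE // -addrA -/c.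
      by have := sqr_ge0 (pair_noise G p S i - c); lra.
    rewrite expr_div_n.
    have -> : 8 * (w i / t i ^+ 2) + 2 * (w i / t i ^+ 4 * pair_noise G p S i ^+ 2) =
       w i / t i ^+ 4 * (8 * t i ^+ 2 + 2 * pair_noise G p S i ^+ 2).
      by field; rewrite gt_eqF.
    by rewrite mulrCA mulrC ler_wpM2l.
  rewrite big_split /= -!mulr_sumr -/(quartic S).
  have : \sum_i w i / t i ^+ 2 <= S2 / D ^+ 2.
    rewrite -w_sum mulr_suml; apply: ler_sum => i _.
    by rewrite ler_wpM2l // lef_pV2 ?posrE ?exprn_gt0 // lerXn2r // nnegrE ltW.
  have -> : (8 * S2 / D + 2 * eta ^+ 2) / D = 8 * (S2 / D ^+ 2) + 2 * (eta ^+ 2 / D).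
    by field; rewrite gt_eqF.
  by move=> h; apply: lerD; rewrite ler_wpM2l.
Qed.

End ConcentrationBound.

(** * The bound at a fixed error *)

Lemma min_degree_le n (G : graph n) i : (min_degree G <= degree G i)%N.
Proof.
rewrite /min_degree; have := mem_index_enum i.
elim: (index_enum _) => // j s IH; rewrite inE big_cons => /orP[/eqP ->|/IH h].
  exact: geq_minl.
exact: leq_trans (geq_minr _ _) h.
Qed.

Lemma sqrt_sum_le (R : rcfType) (x y : R) : 0 <= x -> 0 <= y ->
  Num.sqrt (x + y) <= Num.sqrt x + Num.sqrt y.
Proof.
move=> x0 y0; rewrite -(@ler_pXn2r _ 2) ?nnegrE ?addr_ge0 ?sqrtr_ge0 //.
rewrite sqr_sqrtr ?addr_ge0 // sqrrD !sqr_sqrtr //.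
have : 0 <= Num.sqrt x * Num.sqrt y *+ 2 by rewrite mulrn_wge0 // mulr_ge0 ?sqrtr_ge0.
lra.
Qed.

Lemma expR_le_sqr1D (R : realType) (theta : R) : 0 <= theta <= 1 ->
  expR theta <= (1 + theta) ^+ 2.
Proof.
move=> /andP[th0 th1].
have h : expR (theta / 2) <= 1 + theta.
  have h2 : theta / 2 <= 2^-1 by lra.
  apply: (le_trans (expR_le_quadratic h2)).
  have -> : 2 * (theta / 2) ^+ 2 = theta ^+ 2 / 2 by field.
  have : theta ^+ 2 <= theta by rewrite expr2 ler_piMl.
  lra.
have {1}-> : theta = 2 * (theta / 2) by field.
by rewrite expRM_natl lerXn2r ?nnegrE ?expR_ge0 // addr_ge0.
Qed.

Lemma expRN_ln_double (R : realType) (n : nat) : (0 < n)%N ->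
  expR (- (2 * ln n%:R)) = n%:R^-1 ^+ 2 :> R.
Proof. by move=> n0; rewrite expRN expRM_natl lnK ?posrE ?ltr0n // exprVn. Qed.

(** A factor [1 + theta] to spare at each step of the walks makes up for the
    dimension [n] once the walks have length of order [ln n / theta]. *)
Lemma geometric_tail (R : realType) (n r : nat) (theta : R) :
  (0 < n)%N -> 0 < theta <= 1 -> 2 * ln n%:R / theta <= r%:R ->
  n%:R * (1 + theta)^-1 ^+ r.*2 <= n%:R^-1.
Proof.
move=> n0 /andP[th0 th1]; rewrite ler_pdivrMr // => hr.
have nR : 0 < n%:R :> R by rewrite ltr0n.
have t1 : 0 < 1 + theta by rewrite addr_gt0.
have -> : n%:R^-1 = n%:R * expR (- (2 * ln n%:R)) :> R.
  by rewrite expRN_ln_double //; field; rewrite gt_eqF.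
rewrite ler_wpM2l ?(ltW nR) // exprVn expRN lef_pV2 ?posrE ?expR_gt0 ?exprn_gt0 //.
apply: (@le_trans _ _ (expR theta ^+ r)); first by rewrite -expRM_natl ler_expR.
rewrite -mul2n exprM lerXn2r ?nnegrE ?expR_ge0 ?exprn_ge0 ?(ltW t1) //.
by rewrite expR_le_sqr1D // (ltW th0).
Qed.

Section Scale.
Variables (R : rcfType) (theta B l D : R).
Hypothesis th0 : 0 < theta.
Hypothesis B0 : 0 < B.
Hypothesis l1 : 1 <= l.
Hypothesis D0 : 0 < D.
Hypothesis hDl : B ^+ 2 * l ^+ 4 <= D.

Let l0 : 0 < l. Proof. exact: lt_le_trans l1. Qed.
Let s0 : 0 < Num.sqrt D. Proof. by rewrite sqrtr_gt0. Qed.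

Lemma sqrt_density_ge : B * l ^+ 2 <= Num.sqrt D.
Proof.
rewrite -(@ler_pXn2r _ 2) ?nnegrE ?mulr_ge0 ?exprn_ge0 ?(ltW B0) ?(ltW s0) ?(ltW l0) //.
by rewrite sqr_sqrtr ?(ltW D0) // exprMn -exprM.
Qed.

Lemma degree_ratio_le : 12 / B <= theta -> 4 * Num.sqrt l / Num.sqrt D <= theta.
Proof.
move=> B_q2; have sl2 : Num.sqrt l <= l ^+ 2.
  rewrite -(@ler_pXn2r _ 2) ?nnegrE ?sqrtr_ge0 ?exprn_ge0 ?(ltW l0) //.
  by rewrite sqr_sqrtr ?(ltW l0) // -exprM -[leLHS]expr1 ler_weXn2l.
apply: (@le_trans _ _ (4 / B)).
  rewrite ler_pdivrMr // mulrAC ler_pdivlMr // -mulrA ler_wpM2l //.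
  rewrite mulrC; apply: le_trans sqrt_density_ge; by rewrite ler_wpM2l // ltW.
by apply: le_trans B_q2; rewrite ler_pM2r ?invr_gt0 // ler_nat.
Qed.

Lemma walk_length_le (r : nat) : (4 / theta + 3) ^+ 2 / B <= theta ->
  r%:R <= 2 * l / theta + 1 -> (Num.sqrt D)^-1 * r.*2.+1%:R ^+ 2 <= theta.
Proof.
move=> B_q1 r_le.
have h : r.*2.+1%:R <= (4 / theta + 3) * l.
  have -> : r.*2.+1%:R = 2 * r%:R + 1 :> R by rewrite -addn1 natrD -mul2n natrM.
  have -> : (4 / theta + 3) * l = 2 * (2 * l / theta) + 3 * l by ring.
  by set q := 2 * l / theta in r_le *; have := l1; lra.
have h2 : r.*2.+1%:R ^+ 2 <= (4 / theta + 3) ^+ 2 * l ^+ 2 :> R.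
  by rewrite -exprMn lerXn2r ?nnegrE // (le_trans _ h).
apply: le_trans B_q1; rewrite mulrC ler_pdivrMr // mulrAC ler_pdivlMr //.
apply: (le_trans (ler_wpM2r (ltW B0) h2)).
by rewrite -mulrA ler_wpM2l ?sqr_ge0 // mulrC sqrt_density_ge.
Qed.
End Scale.

(** Of the 32 [theta], 22 pay for the corrections to the factor 2, one for [N],
    2 for the fluctuation of the first-order part of [M] and 6 for its
    second-order part. *)
Lemma error_budget (R : rcfType) (theta D l g base S2 : R) :
  let a := 4 * Num.sqrt l / Num.sqrt D in
  let tau := base * (1 + theta) in
  0 < theta <= 32^-1 -> 0 < D -> 0 < l -> 0 < g -> 0 <= S2 ->
  a <= theta -> 0 <= base <= 2 + theta -> 12 / g <= theta -> S2 / D <= (theta / 12) ^+ 2 ->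
  tau / Num.sqrt D * (1 + a) ^+ 2 + 1 / (g * Num.sqrt l) * (2 * a + a ^+ 2) +
  (Num.sqrt ((S2 + 2 * theta ^+ 2) / D) +
   3 * Num.sqrt ((8 * S2 / D + 2 * (theta ^+ 2) ^+ 2) / D)) <=
  (2 + Num.sqrt S2 + 32 * theta) * (1 / Num.sqrt D).
Proof.
move=> a tau /andP[th0 th1] D0 l0 g0 S20 aB /andP[bl bu] hg S2D.
set s := Num.sqrt D in a aB *; set sl := Num.sqrt l in a aB *.
have s0 : 0 < s by rewrite sqrtr_gt0.
have sl0 : 0 < sl by rewrite sqrtr_gt0.
have a0 : 0 <= a by rewrite /a divr_ge0 ?mulr_ge0 // ltW.
have th0' := ltW th0.
have t1 : theta <= 1 by apply: le_trans th1 _; rewrite invf_le1 ?ler1n.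
have sq0 : 0 <= theta ^+ 2 by rewrite sqr_ge0.
have zE x : 0 <= x -> Num.sqrt (x / D) = Num.sqrt x / s.
  by move=> x0; rewrite sqrtrM // sqrtrV // ltW.
rewrite !zE; first last.
- by rewrite addr_ge0 ?mulr_ge0.
- by rewrite addr_ge0 ?mulr_ge0 ?invr_ge0 ?exprn_ge0 // ltW.
have b1 : Num.sqrt (S2 + 2 * theta ^+ 2) <= Num.sqrt S2 + 2 * theta.
  apply: (le_trans (sqrt_sum_le _ _)) => //; first by rewrite mulr_ge0.
  rewrite lerD2l -(@ler_pXn2r _ 2) ?nnegrE ?sqrtr_ge0 ?mulr_ge0 //.
  rewrite sqr_sqrtr ?mulr_ge0 // exprMn ler_wpM2r //.
  by rewrite expr2 -natrM ler_nat.
have b2 : Num.sqrt (8 * S2 / D + 2 * (theta ^+ 2) ^+ 2) <= 2 * theta.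
  rewrite -(@ler_pXn2r _ 2) ?nnegrE ?sqrtr_ge0 ?mulr_ge0 //.
  rewrite sqr_sqrtr ?addr_ge0 ?mulr_ge0 ?invr_ge0 ?exprn_ge0 ?(ltW D0) //.
  have i2 : (theta ^+ 2) ^+ 2 <= theta ^+ 2.
    by rewrite expr2 ler_piMl // exprn_ile1.
  have -> : 8 * S2 / D = 8 * (S2 / D) by rewrite mulrA.
  have -> : (2 * theta) ^+ 2 = 4 * theta ^+ 2 by ring.
  have e12 : (theta / 12) ^+ 2 = theta ^+ 2 / 144 by field.
  by move: i2 S2D sq0; rewrite e12; clear; lra.
have b3 : 1 / (g * sl) * (2 * a + a ^+ 2) <= theta / s.
  have -> : 1 / (g * sl) * (2 * a + a ^+ 2) = 4 / g * (2 + a) / s.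
    by rewrite /a; clearbody s sl; field; rewrite !gt_eqF.
  rewrite ler_pM2r ?invr_gt0 //.
  apply: (@le_trans _ _ (12 / g)); last exact: hg.
  have -> : 12 / g = 4 / g * 3 by field; rewrite gt_eqF.
  rewrite ler_wpM2l ?divr_ge0 ?(ltW g0) //.
  by move: aB t1; clear; lra.
have b4 : tau * (1 + a) ^+ 2 <= 2 + 22 * theta.
  apply: (@le_trans _ _ ((2 + theta) * (1 + theta) * (1 + theta) ^+ 2)).
    apply: ler_pM; rewrite ?sqr_ge0 // /tau.
    - by rewrite mulr_ge0 // addr_ge0.
    - by rewrite ler_wpM2r // addr_ge0.
    - by apply: lerXn2r; rewrite ?nnegrE ?addr_ge0 // lerD2l.
  have t2 : theta ^+ 2 <= theta / 32 by rewrite expr2 ler_wpM2l.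
  have t3 : theta ^+ 3 <= theta / 32.
    by apply: le_trans t2; rewrite exprS ler_piMl.
  have t4 : theta ^+ 4 <= theta / 32.
    by apply: le_trans t3; rewrite exprS ler_piMl ?exprn_ge0.
  by move: t2 t3 t4 th0'; clear; lra.
have -> : tau / s * (1 + a) ^+ 2 = tau * (1 + a) ^+ 2 / s by rewrite mulrAC.
have -> : Num.sqrt (S2 + 2 * theta ^+ 2) / s +
    3 * (Num.sqrt (8 * S2 / D + 2 * (theta ^+ 2) ^+ 2) / s) =
  (Num.sqrt (S2 + 2 * theta ^+ 2) + 3 * Num.sqrt (8 * S2 / D + 2 * (theta ^+ 2) ^+ 2)) / s.
  by rewrite mulrA -mulrDl.
rewrite [1 / s]mul1r.
apply: (@le_trans _ _ ((2 + 22 * theta) / s + theta / s +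
    (Num.sqrt S2 + 2 * theta + 3 * (2 * theta)) / s)).
  apply: lerD; first apply: lerD => //.
    by rewrite ler_pM2r ?invr_gt0.
  by rewrite ler_pM2r ?invr_gt0 // lerD // ler_wpM2l.
rewrite -!mulrDl ler_pM2r ?invr_gt0 //.
by move: th0'; clear; lra.
Qed.

Definition density_threshold (R : realType) (eps : R) : R :=
  let theta := eps / 32 in
  (4 / theta + 3) ^+ 2 / theta + 12 / theta + 12 / (eps * theta ^+ 4) + 1.

(** The threshold only serves to make these four inequalities hold at once. *)
Lemma density_thresholdP (R : realType) (eps : R) : 0 < eps ->
  let theta := eps / 32 in let B := density_threshold eps in
  [/\ 1 <= B, (4 / theta + 3) ^+ 2 / B <= theta, 12 / B <= theta
    & 12 / (eps * theta ^+ 4) <= B].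
Proof.
move=> e0 theta B.
have th0 : 0 < theta by rewrite divr_gt0.
have q1_0 : 0 <= (4 / theta + 3) ^+ 2 / theta by rewrite divr_ge0 ?sqr_ge0 // ltW.
have q2_0 : 0 <= 12 / theta by rewrite divr_ge0 // ltW.
have q3_0 : 0 <= 12 / (eps * theta ^+ 4) by rewrite divr_ge0 // mulr_ge0 ?exprn_ge0 // ltW.
have : B = (4 / theta + 3) ^+ 2 / theta + 12 / theta + 12 / (eps * theta ^+ 4) + 1 by [].
move: q1_0 q2_0 q3_0; set q1 := _ / theta; set q2 := _ / theta; set q3 := _ / (eps * _).
clearbody B => q1_0 q2_0 q3_0 BE.
have B1 : 1 <= B by move: BE q1_0 q2_0 q3_0; clear; lra.
have B0 : 0 < B by apply: lt_le_trans B1.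
have low x : x / theta <= B -> x / B <= theta.
  by rewrite !ler_pdivrMr // mulrC.
split => //; [apply: low|apply: low|]; rewrite BE.
- by rewrite -/q1; move: q1_0 q2_0 q3_0; clear; lra.
- by rewrite -/q2; move: q1_0 q2_0 q3_0; clear; lra.
- by move: q1_0 q2_0 q3_0; clear; lra.
Qed.

(** With [theta = eps / 32], the parameters are [a = 4 sqrt (ln n / D)] for the
    degrees, for which the Chernoff bound is [n^-2], walks of length
    [2 r ~ 4 ln n / theta] for the trace, and [eta = theta^2] for the weighted
    sums.  [B] is only required to be large in terms of [eps]. *)
Lemma laplacian_percolation_bound (R : realType) n (G : graph n)
    (p g eps : R) (k : nat) :
  let B := density_threshold eps in
  let D := p * (min_degree G)%:R in
  let exc := exceptional_eigenvalues g (laplacian R G) in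
  0 < eps <= 1 -> 0 <= p <= 1 -> 6 / eps <= n%:R -> 1 <= ln n%:R :> R ->
  B <= g -> size exc = k -> B ^+ 2 * k%:R <= D -> B ^+ 2 * ln n%:R ^+ 4 <= D ->
  1 - eps <= percolation_prob G p (fun H : graph n =>
      [forall i : 'I_n,
        `|lambda (laplacian R H) i - lambda (laplacian R G) i| <=
        (2 + Num.sqrt (\sum_(x <- exc) (1 - x) ^+ 2) + eps) * (1 / Num.sqrt D)]).
Proof.
move=> B D exc /andP[e0 e1] p01 hn hl hg hk hDk hDl.
set l : R := ln n%:R in hl hDl.
have [] := density_thresholdP e0; rewrite -/B.
set theta : R := eps / 32 => B1 B_q1 B_q2 B_q3.
clearbody B.
have th0 : 0 < theta by rewrite divr_gt0.
have th1 : theta <= 32^-1 by rewrite /theta -[leRHS]mul1r ler_pM2r ?invr_gt0.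
have t1 : theta <= 1 by apply: le_trans th1 _; rewrite invf_le1 ?ler1n.
have B0 : 0 < B by apply: lt_le_trans B1.
have B2 : B <= B ^+ 2 by rewrite expr2 ler_peMr // ltW.
have l40 : 1 <= l ^+ 4 by rewrite exprn_ege1.
have D1 : 1 <= D.
  by apply: le_trans hDl; rewrite -[leLHS]mulr1 ler_pM // (le_trans B1).
have D0 : 0 < D by apply: lt_le_trans D1.
have l0 : 0 < l by apply: lt_le_trans hl.
set s := Num.sqrt D.
have s0 : 0 < s by rewrite sqrtr_gt0.
pose a := 4 * Num.sqrt l / s.
have a0 : 0 < a by rewrite divr_gt0 // mulr_gt0 // sqrtr_gt0.
have aB : a <= theta by apply: (degree_ratio_le B0 hl D0 hDl).
have a2 : a <= 2^-1.
  by apply: (le_trans aB); apply: (le_trans th1); rewrite lef_pV2 ?posrE // ler_nat.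
have a12 : 0 < a <= 2^-1 by rewrite a0.
have aD : a ^+ 2 * D / 8 = 2 * l.
  rewrite /a expr_div_n exprMn !sqr_sqrtr ?(ltW l0) ?(ltW D0) //.
  by move: D0; clear => D0; clearbody D; field; rewrite gt_eqF.
pose r := (Num.truncn (2 * l / theta)).+1.
have /andP[r_ge r_le] : 2 * l / theta <= r%:R <= 2 * l / theta + 1.
  have z0 : 0 <= 2 * l / theta by rewrite divr_ge0 ?mulr_ge0 // ltW.
  have /andP[h1 h2] := truncn_itv z0.
  by rewrite /r (ltW h2) /= -natr1 lerD2r.
pose base : R := 2 + s^-1 * r.*2.+1%:R ^+ 2.
have base_le : base <= 2 + theta by rewrite lerD2l; apply: (walk_length_le B0 hl D0 hDl).
have base0 : 0 < base.
  by rewrite ltr_wpDr // mulr_ge0 ?exprn_ge0 // invr_ge0 ltW.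
pose tau := base * (1 + theta).
have th10 : 0 < 1 + theta by rewrite addr_gt0.
have tau0 : 0 < tau by rewrite mulr_gt0.
pose eta := theta ^+ 2.
have eta0 : 0 < eta by rewrite exprn_gt0.
have dG i : (min_degree G)%:R <= (degree G i)%:R :> R by rewrite ler_nat min_degree_le.
have dm0 : 0 < (min_degree G)%:R :> R.
  by rewrite lt_def ler0n andbT; apply: contraTneq D0; rewrite /D => ->; rewrite mulr0 ltxx.
have deg0 i : (0 < degree G i)%N.
  by rewrite -(ltr0n R); apply: lt_le_trans (dG i).
have g0 : 0 < g by apply: lt_le_trans hg.
pose nu := 1 / (g * Num.sqrt l).
have nu0 : 0 <= nu by rewrite divr_ge0 // mulr_ge0 ?sqrtr_ge0 // ltW.
have [M [N [BMN [Ms Ns] Mrow Msum hN]]] := spectral_split dm0 nu0 dG.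
set S2 := \sum_(x <- exc) (1 - x) ^+ 2.
have {}Msum : \sum_i \sum_j M i j ^+ 2 = S2 by [].
have S2k : S2 <= k%:R.
  by rewrite -hk; apply: (@exceptional_sum_le _ _ G (1 / (g * Num.sqrt (ln n%:R)))).
have S20 : 0 <= S2 by rewrite sumr_ge0 // => x _; rewrite sqr_ge0.
have S2D : S2 / D <= (B ^+ 2)^-1.
  rewrite ler_pdivrMr // [_^-1 * D]mulrC ler_pdivlMr ?exprn_gt0 // mulrC.
  by apply: le_trans hDk; rewrite ler_wpM2l // exprn_ge0 // ltW.
pose w i := \sum_j M i j ^+ 2.
have w0 i : 0 <= w i by rewrite sumr_ge0 // => j _; rewrite sqr_ge0.
have n0R : 0 < n%:R :> R by apply: lt_le_trans hn; rewrite divr_gt0.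
have n0 : (0 < n)%N by rewrite -(ltr0n R).
have cost_le : expect (edges G) p (deviation_cost G p (min_degree G)%:R a tau eta r w) <= eps.
  apply: (le_trans (expected_deviation_cost p01 dG D1 r a12 tau0 eta0 w0 Mrow Msum)).
  rewrite -/D -/s -/base aD.
  have h1 : n%:R * (base / tau) ^+ r.*2 <= n%:R^-1.
    have -> : base / tau = (1 + theta)^-1.
      by rewrite /tau invfM mulrA divff ?mul1r // gt_eqF.
    by apply: geometric_tail; rewrite ?th0.
  have h2 : 2 * n%:R * expR (- (2 * l)) = 2 * n%:R^-1 :> R.
    by rewrite expRN_ln_double // expr2 mulrA -(mulrA 2) divff ?mulr1 // gt_eqF.
  have h3 : 6 * S2 / (D * eta ^+ 2) <= eps / 2.
    have t4 : 0 < theta ^+ 4 by rewrite exprn_gt0.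
    have -> : 6 * S2 / (D * eta ^+ 2) = 6 / theta ^+ 4 * (S2 / D).
      by rewrite /eta -exprM invfM [D^-1 * _]mulrC mulrACA.
    apply: (@le_trans _ _ (6 / theta ^+ 4 * (B ^+ 2)^-1)).
      by rewrite ler_wpM2l // divr_ge0 // ltW.
    rewrite ler_pdivrMr ?exprn_gt0 // ler_pdivrMr //.
    have := le_trans B_q3 B2; rewrite ler_pdivrMr ?mulr_gt0 //.
    by clear; lra.
  have h4 : n%:R^-1 <= eps / 6.
    by rewrite -[leRHS]invf_div lef_pV2 ?posrE ?divr_gt0.
  by rewrite h2; move: h1 h3 h4; clear; lra.
apply: le_trans (_ : 1 - expect (edges G) p (deviation_cost G p (min_degree G)%:R a tau eta r
  w) <= _).
  by rewrite lerB.
apply: percolation_prob_ge => //.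
  by move=> S _; apply: (deviation_cost_ge0 p01 dG D1 a r tau0 eta0 w0).
move=> S SE lt1; apply/forallP => i.
have [c1 c2 c3 c4] := deviation_cost_lt1 p01 dG D1 a12 tau0 eta0 (ltn0Sn _) w0 Msum SE lt1.
have tpos j : 0 < mean_degree G p j by apply: lt_le_trans (mean_degree_ge p01 dG D0 j).
have pp : 0 < p by apply: retention_gt0 p01 D0.
have c00 : 0 <= tau / s by rewrite divr_ge0 // ltW.
have hC v : `|qform (\matrix_(i, j) (((spanning_subgraph G S i j)%:R - p * (G i j)%:R)
      / (Num.sqrt (mean_degree G p i) * Num.sqrt (mean_degree G p j)))) v| <= tau / s * sqnorm v.
  have <- : normalized_noise G p S = \matrix_(i, j) (((spanning_subgraph G S i j)%:R - p * (G i
    j)%:R)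
      / (Num.sqrt (mean_degree G p i) * Num.sqrt (mean_degree G p j))).
    by apply/matrixP => j j'; rewrite !mxE noiseE.
  exact: c1.
apply: (le_trans (laplacian_comparison i pp tpos c2 a2 c00 nu0 BMN Ms Ns hN hC c3 c4)).
have -> : eps = 32 * theta by rewrite /theta mulrC divfK.
apply: error_budget => //.
- by rewrite th0.
- by rewrite (ltW base0).
- by apply: le_trans B_q2; rewrite ler_wpM2l // lef_pV2 ?posrE.
- apply: (le_trans S2D); rewrite -exprVn; apply: lerXn2r; rewrite ?nnegrE ?invr_ge0.
  + exact: ltW.
  + by rewrite divr_ge0 // ltW.
  + by rewrite ler_pdivlMr // mulrC.
Qed.

(** * Letting the error tend to zero *)

Local Open Scope classical_set_scope.
Local Open Scope ring_scope.

Lemma percolation_prob_ge0_le1 (R : realType) n (G : graph n) (p : R)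
    (Q : graph n -> bool) : 0 <= p <= 1 -> 0 <= percolation_prob G p Q <= 1.
Proof.
move=> p01; rewrite percolation_probE expect_ge0 //= -[leRHS](expect_cst (edges G) p).
by apply: expect_le => // S _; case: (Q _).
Qed.

(** Take for [eps n] the smallest [1 / (m + 1)] with [m <= n] for which the
    bound already holds at [n]. *)
Lemma diagonal_rate (R : realType) (P : nat -> R -> R) :
  (forall n e, 0 <= P n e <= 1) ->
  (forall e, 0 < e <= 1 -> \forall n \near \oo, 1 - e <= P n e) ->
  exists2 eps : nat -> R, eps n @[n --> \oo] --> 0 & P n (eps n) @[n --> \oo] --> (1 : R).
Proof.
move=> P01 hP.
pose e_ m : R := m.+1%:R^-1.
have e_01 m : 0 < e_ m <= 1 by rewrite invr_gt0 ltr0n /= invf_le1 ?ler1n ?ltr0n.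
pose good n (m : 'I_n.+1) := 1 - e_ m <= P n (e_ m).
pose M n : nat := \max_(m | good n m) m.
(* The index 0 is always good because [e_ 0 = 1]; hence the maximum is attained. *)
have goodM n : 1 - e_ (M n) <= P n (e_ (M n)).
  have [|m gm Mm] := @eq_bigmax_cond _ (good n) (@nat_of_ord n.+1).
    apply/card_gt0P; exists ord0; rewrite unfold_in /good /e_ invr1 subrr.
    by case/andP: (P01 n 1).
  rewrite /M; have -> : \max_(m | good n m) m = m by exact: Mm.
  exact: gm.
have M_large e : 0 < e -> \forall n \near \oo, e_ (M n) <= e.
  move=> e0; pose m := Num.truncn e^-1.
  have me : e_ m <= e.
    rewrite /e_ -[leRHS]invrK lef_pV2 ?posrE ?invr_gt0 ?ltr0n //.
    have e0' : 0 <= e^-1 by rewrite invr_ge0 ltW.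
    by have /andP[_ /ltW] := truncn_itv e0'.
  have h1 := hP (e_ m) (e_01 m).
  have h2 : \forall n \near \oo, (m <= n)%N by exact: nbhs_infty_ge.
  near=> n; have nm : (m < n.+1)%N by rewrite ltnS; near: n.
  have gm : good n (Ordinal nm) by rewrite /good /=; near: n.
  apply: le_trans me; rewrite /e_ lef_pV2 ?posrE ?ltr0n // ler_nat ltnS.
  exact: (@leq_bigmax_cond _ (good n) (@nat_of_ord n.+1) _ gm).
exists (fun n => e_ (M n)).
  apply/cvgrPdist_le => e e0; near=> n.
  rewrite sub0r normrN ger0_norm; last by case/andP: (e_01 (M n)) => /ltW.
  by near: n; apply: M_large.
apply/cvgrPdist_le => e e0; near=> n.
have /andP[_ P1] := P01 n (e_ (M n)).
rewrite ger0_norm ?subr_ge0 // lerBlDl -lerBlDr.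
apply: le_trans (goodM n); rewrite lerD2l lerN2.
by near: n; apply: M_large.
Unshelve. all: by end_near.
Qed.

Theorem theorem4 (R : realType)
    (G : forall n : nat, graph n) (p : nat -> R) (g : nat -> R) (k : nat -> nat)
    (g_infty : g n @[n --> \oo] --> +oo)
    (k_exceptional : forall n,
      size (exceptional_eigenvalues (g n) (laplacian R (G n))) = k n)
    (delta_large : much_larger (fun n => (min_degree (G n))%:R : R)
      (fun n => Num.max (k n)%:R (ln n%:R ^+ 4)))
    (p_large : much_larger p
      (fun n => Num.max ((k n)%:R / (min_degree (G n))%:R)
                        (ln n%:R ^+ 4 / (min_degree (G n))%:R)))
    (p01 : forall n, 0 <= p n <= 1) :
  exists2 eps : nat -> R, eps n @[n --> \oo] --> 0 &
    percolation_prob (G n) (p n) (fun H : graph n =>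
      [forall i : 'I_n,
        `|lambda (laplacian R H) i - lambda (laplacian R (G n)) i| <=
        (2 + Num.sqrt (\sum_(x <- exceptional_eigenvalues (g n)
                               (laplacian R (G n))) (1 - x) ^+ 2) + eps n)
        * (1 / Num.sqrt (p n * (min_degree (G n))%:R))])
      @[n --> \oo] --> (1 : R).
Proof.
pose P n e := percolation_prob (G n) (p n) (fun H : graph n =>
      [forall i : 'I_n,
        `|lambda (laplacian R H) i - lambda (laplacian R (G n)) i| <=
        (2 + Num.sqrt (\sum_(x <- exceptional_eigenvalues (g n)
                               (laplacian R (G n))) (1 - x) ^+ 2) + e)
        * (1 / Num.sqrt (p n * (min_degree (G n))%:R))]).
apply: (@diagonal_rate R P) => [n e|e e01]; first exact: percolation_prob_ge0_le1.
pose B := density_threshold e.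
have B1 : 1 <= B by have [e0 _] := andP e01; have [] := density_thresholdP e0.
have h1 := nbhs_infty_ger (6 / e).
have h2 := nbhs_infty_ger (expR 1 : R).
have h3 : \forall n \near \oo, B <= g n by move/cvgryPge : g_infty; apply.
have h4 : \forall n \near \oo, B ^+ 2 <= p n / Num.max ((k n)%:R / (min_degree (G n))%:R)
    (ln n%:R ^+ 4 / (min_degree (G n))%:R) by move/cvgryPge : p_large; apply.
near=> n.
have n6 : 6 / e <= n%:R by near: n.
have ne : expR 1 <= n%:R :> R by near: n.
have ln1 : 1 <= ln n%:R :> R.
  by rewrite -[leLHS]expRK ler_ln ?posrE ?expR_gt0 // (lt_le_trans (expR_gt0 1)).
have gB : B <= g n by near: n.
have : B ^+ 2 <= p n / Num.max ((k n)%:R / (min_degree (G n))%:R)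
                        (ln n%:R ^+ 4 / (min_degree (G n))%:R) by near: n.
set d : R := (min_degree (G n))%:R; set m := Num.max _ _ => pm.
have B20 : 0 < B ^+ 2 by rewrite exprn_gt0 // (lt_le_trans _ B1).
have m0 : 0 < m.
  have : 0 <= m by rewrite /m le_max divr_ge0.
  rewrite le_eqVlt => /orP[/eqP m0|//].
  by move: pm; rewrite -m0 invr0 mulr0 leNgt B20.
have d0 : 0 < d.
  rewrite lt_def ler0n andbT; apply/negP => /eqP d0.
  by move: m0; rewrite /m d0 invr0 !mulr0 maxxx ltxx.
rewrite ler_pdivlMr // in pm.
have mk x : x / d <= m -> B ^+ 2 * x <= p n * d.
  move=> xm; rewrite -ler_pdivrMr // -mulrA; apply: le_trans pm.
  by rewrite ler_wpM2l // ltW.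
by apply: (@laplacian_percolation_bound R n (G n) (p n) (g n) e (k n)) => //;
   apply: mk; rewrite /m le_max lexx ?orbT.
Unshelve. all: by end_near.
Qed.
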